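(* Consider the multi-community preferential attachment model with types described in the context. 1. Let $z^*$ be a stable fixed point of the polynomial $R$ such that $R$ is increasing in some neighbourhood of $z^*$. Then there is positive probability that $Z^{(t)}_i\to z^*$ as $t\to\infty$ for all $i\in S$. 2. Assume there is positive probability that $Z^{(t)}_i\to z^*$ as $t\to\infty$ for all $i\in S$. Then $z^*$ is a fixed point of $R$.
   Context: Model. $S=\{1,\dots,N\}$ is a finite set of communities, $m\ge 1$ is an integer, $\mu=(\mu_i)_{i\in S}$ is a probability distribution on $S$ with $\mu_i>0$ for all $i$, and $A=(\alpha_{x,y})_{x,y\in S}$ (the attractiveness matrix) has non-negative entries with $\sum_x\alpha_{x,y}>0$ for every $y$. The type assignment rule is given by $p_0,\dots,p_m\in[0,1]$. $G_0$ is a fixed finite initial (multi)graph with $n_0$ vertices and $mn_0$ edges, all vertices having positive degree; each vertex $v$ has a community $c(v)\in S$ and a type (colour), red or blue, and each community contains at least one vertex of $G_0$. Given $G_t$, the graph $G_{t+1}$ is obtained by adding a vertex $v_{t+1}$ whose community $c(v_{t+1})$ has law $\mu$, independently of everything else, and $m$ edges from $v_{t+1}$ to $m$ existing vertices chosen independently with replacement, each choice being equal to vertex $v$ with probability $$\frac{\alpha_{c(v),c(v_{t+1})}\deg_{G_t}(v)}{\sum_{u\in V(G_t)}\alpha_{c(u),c(v_{t+1})}\deg_{G_t}(u)}.$$ Then, conditional on exactly $k$ of the $m$ chosen neighbours (with multiplicity) being red, $v_{t+1}$ becomes red with probability $p_k$ and otherwise blue; types never change afterwards. $Z^{(t)}_i=\dfrac{\sum_{v\text{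 red},\,c(v)=i}\deg_{G_t}(v)}{\sum_{v:\,c(v)=i}\deg_{G_t}(v)}$ is the proportion of edge-ends in community $i$ at time $t$ which are at red vertices. The polynomial of the rule is $R(z)=\sum_{k=0}^m\binom mk z^k(1-z)^{m-k}p_k$. A fixed point $z\in(0,1)$ of $R$ is stable if for some $\eta>0$, $R(y)>y$ for $y\in(z-\eta,z)$ and $R(y)<y$ for $y\in(z,z+\eta)$. A fixed point at $0$ is stable if $R(y)<y$ for $y\in(0,\eta)$ for some $\eta>0$; a fixed point at $1$ is stable if $R(y)>y$ for $y\in(1-\eta,1)$ for some $\eta>0$.
   Formalization: Part 1 additionally assumes that with positive probability, at some time, all Z_i>0 (if z*>0) and all Z_i<1 (if z*<1); this is necessary: e.g. with G_0 all red and p_m=1, all Z_i stay at 1. *)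

(* Defs.v *)
From HB Require Import structures.
From mathcomp Require Import all_boot all_order all_algebra.
From mathcomp Require Import all_classical all_reals all_analysis.

Set Implicit Arguments.
Unset Strict Implicit.
Unset Printing Implicit Defensive.

Import Order.TTheory GRing.Theory Num.Theory.
Import numFieldNormedType.Exports.

Local Open Scope classical_set_scope.
Local Open Scope ring_scope.

(* A finite multigraph with communities in 'I_N and two types: the list of the
   (community, is-red) labels of its vertices, which are named 0, 1, ... in
   order of arrival, and the list of its edges, in order of arrival. Parallel
   edges and loops are allowed. *)
Definition mgraph (N : nat) : Type :=
  (seq ('I_N * bool) * seq (nat * nat))%type.

Section Graph.
Variables (N : nat) (g : mgraph N).

Definition nv : nat := size g.1.
Definition comm (v : 'I_nv) : 'I_N := (tnth (in_tuple g.1) v).1.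
Definition red (v : 'I_nv) : bool := (tnth (in_tuple g.1) v).2.

(* a loop counts twice *)
Definition deg (v : 'I_nv) : nat :=
  (\sum_(e <- g.2) ((e.1 == v :> nat) + (e.2 == v :> nat)))%N.

Definition add_vertex (m : nat) (y : 'I_N) (s : m.-tuple 'I_nv) (b : bool) :
    mgraph N :=
  (rcons g.1 (y, b), g.2 ++ [seq (nv, nat_of_ord v) | v <- s]).

Definition initial_graph (m : nat) : Prop :=
  [/\ size g.2 = (m * nv)%N,
      forall e, e \in g.2 -> (e.1 < nv)%N && (e.2 < nv)%N,
      forall v : 'I_nv, (0 < deg v)%N
    & forall i : 'I_N, exists v : 'I_nv, comm v = i].

End Graph.

Section Model.
Variables (R : realType) (N m : nat).
Variables (mu : 'I_N -> R) (alpha : 'M[R]_N) (p : nat -> R).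
Implicit Types (g : mgraph N) (y i : 'I_N).

Definition attach_prob g y (v : 'I_(nv g)) : R :=
  alpha (comm v) y * (deg v)%:R /
  \sum_(u : 'I_(nv g)) alpha (comm u) y * (deg u)%:R.

Definition nb_red g (s : m.-tuple 'I_(nv g)) : nat := count (@red N g) s.

Definition step_prob g y (s : m.-tuple 'I_(nv g)) (b : bool) : R :=
  mu y * (\prod_(v <- s) attach_prob y v) *
  (if b then p (nb_red s) else 1 - p (nb_red s)).

(* Conditional law of the new vertex given the past. Since edges are recorded
   in the order in which they are chosen, [add_vertex g] is injective in
   (y, s, b), so each transition of the process comes from a single triple. *)
Definition pa_process d (T : measurableType d) (P : probability T R)
    (g0 : mgraph N) (G : nat -> T -> mgraph N) : Prop :=
  [/\ forall t g, measurable [set w | G t w = g],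
      forall w, G 0%N w = g0
    & forall (t : nat) (h : nat -> mgraph N) y
             (s : m.-tuple 'I_(nv (h t))) (b : bool),
        P ([set w | forall k, (k <= t)%N -> G k w = h k]
             `&` [set w | G t.+1 w = add_vertex y s b]) =
        (P [set w | forall k, (k <= t)%N -> G k w = h k]
          * (step_prob y s b)%:E)%E].

Definition red_prop g i : R :=
  (\sum_(v : 'I_(nv g) | red v && (comm v == i)) (deg v)%:R) /
  (\sum_(v : 'I_(nv g) | comm v == i) (deg v)%:R).

Definition rule_poly : {poly R} :=
  \sum_(k < m.+1) ('C(m, k)%:R * p k) *: ('X^k * (1 - 'X) ^+ (m - k)).

(* The event that the proportions in all communities converge to z. *)
Definition converge_to (T : Type) (G : nat -> T -> mgraph N) (z : R) : set T :=
  [set w | forall i, red_prop (G t w) i @[t --> \oo] --> z].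

(* With positive probability, at some time, no community is monochromatic of a
   colour which prevents z from being approached. This is necessary for
   [converge_to G z] to have positive probability, and it can fail: if all the
   initial vertices are red and p m = 1, then all the proportions stay at 1.
   It holds whenever every community initially has vertices of both types. *)
Definition attainable d (T : measurableType d) (P : probability T R)
    (G : nat -> T -> mgraph N) (z : R) : Prop :=
  exists t,
    let E := [set w | forall i, (0 < z -> 0 < red_prop (G t w) i)
                             /\ (z < 1 -> red_prop (G t w) i < 1)] in
    (0 < P E)%E.

End Model.

Definition stable_fixpoint (R : realType) (r : {poly R}) (z : R) : Prop :=
  r.[z] = z /\
  [\/ 0 < z < 1 /\
        (exists2 eta : R, 0 < eta &
          (forall y, z - eta < y < z -> y < r.[y]) /\
          (forall y, z < y < z + eta -> r.[y] < y)),
      z = 0 /\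
        (exists2 eta : R, 0 < eta & forall y, 0 < y < eta -> r.[y] < y)
    | z = 1 /\
        (exists2 eta : R, 0 < eta & forall y, 1 - eta < y < 1 -> y < r.[y])].

(* The neighbourhood is relative to [0, 1], which matters for z = 0 and z = 1:
   z ^ 2 is increasing near 0 in this sense. *)
Definition increasing_near (R : realType) (r : {poly R}) (z : R) : Prop :=
  exists2 e : R, 0 < e &
    forall x y, 0 <= x <= 1 -> 0 <= y <= 1 -> `|x - z| < e -> `|y - z| < e ->
      x <= y -> r.[x] <= r.[y].

(* Main.v *)
(* Write D_i for the total degree of community i, Z_i for its red proportion, r
   for the polynomial of the rule and q_i for the probability that a neighbour
   chosen by a newcomer of community i is red, a weighted average of the Z_j.
   Given the past, the increment of (red degree of i) - Z_i D_i has mean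
   m mu_i (r(q_i) - Z_i), because attaching to old vertices is neutral on
   average. So Z_i moves by (m mu_i / D_i) (r(q_i) - Z_i) plus noise. Both the
   mean and the second moment of the noise are at most a constant times the
   expected decrease of 1 / D_i, so a potential argument bounds the
   number of fluctuations of size e of the summed noise after time t by a
   constant over e^2 D_i(t); no convergence of D_i(t) / t is needed. Hence the
   noise is almost surely summable, and small for ever with positive probability
   once D_i is large. As m mu_i / D_i is at least of order 1 / t, its sum over
   time diverges.

   Part 2: if all Z_i tend to z, then so do the q_i, and r(z) <> z would make
   Z_i drift to infinity.

   Part 1: as r is increasing near z, the maximum and the minimum of the Z_i obey
   a comparison principle: small noise cannot push them out of a neighbourhood of
   z, and they contract to z. Such a neighbourhood is reached with large degrees
   and positive probability: an admissible choice of colours at each step keeps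
   the sum of (D_i (Z_i - z))^2 of the order of the number of steps. *)
Require Import Defs.
From HB Require Import structures.
From mathcomp Require Import all_boot all_order all_algebra.
From mathcomp Require Import all_classical all_reals all_analysis.
From mathcomp Require Import ring lra.

Set Implicit Arguments.
Unset Strict Implicit.
Unset Printing Implicit Defensive.

Import Order.TTheory GRing.Theory Num.Theory.
Import numFieldNormedType.Exports.

Local Open Scope classical_set_scope.
Local Open Scope ring_scope.

(** * Binomial means, restarted noise and comparison *)

Section BinomialMean.
Variable R : realType.
Implicit Types (f g : nat -> R) (z : R).

(** The mean of [f] at a binomial variable with parameters [m] and [z], by conditioning on the first
    trial. The same recursion governs sums over tuples of chosen neighbours. *)
Fixpoint bin_mean (m : nat) f z : R :=
  if m is m'.+1 then z * bin_mean m' (f \o S) z + (1 - z) * bin_mean m' f z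
  else f 0%N.

Lemma bin_meanE m f z :
  bin_mean m f z =
  \sum_(k < m.+1) 'C(m, k)%:R * z ^+ k * (1 - z) ^+ (m - k) * f k.
Proof.
elim: m f => [|m IH] f /=; first by rewrite big_ord1 /= !expr0 !mul1r.
rewrite !IH [RHS]big_ord_recl [X in _ + _ * X = _]big_ord_recl /=.
rewrite !bin0 !expr0 !subn0 mulrDr addrCA.
congr (_ + _); first by rewrite !mul1r exprS mulrA.
under [RHS]eq_bigr => i _.
  rewrite /bump /= add1n binS natrD subSS !mulrDl; over.
rewrite big_split /= addrC; congr (_ + _).
  rewrite [in RHS]big_ord_recr /= bin_small // !mul0r addr0 mulr_sumr.
  apply: eq_bigr => i _; rewrite /bump /= add1n.
  have -> : (m - i = (m - i.+1).+1)%N by rewrite subnS prednK // subn_gt0.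
  by rewrite [(1 - z) ^+ _.+1]exprS !mulrA -[(1 - z) * _ * _]mulrA [(1 - z) * _]mulrC.
by rewrite mulr_sumr; apply: eq_bigr => i _; rewrite exprS !mulrA [z * _]mulrC.
Qed.

Lemma rule_polyE m f z : (rule_poly m f).[z] = bin_mean m f z.
Proof.
rewrite bin_meanE /rule_poly horner_sum; apply: eq_bigr => k _.
rewrite hornerZ hornerM hornerXn horner_exp hornerD hornerN hornerX hornerC.
by rewrite -!mulrA; congr (_ * _); rewrite mulrC -mulrA.
Qed.

Lemma bin_mean_lin m f g a z :
  bin_mean m (fun k => a * f k + g k) z = a * bin_mean m f z + bin_mean m g z.
Proof.
elim: m f g => [|m IH] f g //=.
by rewrite (IH (f \o S) (g \o S)) IH; ring.
Qed.

Lemma bin_mean_cst m c z : bin_mean m (fun=> c) z = c.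
Proof. by elim: m => [|m IH] //=; rewrite IH; ring. Qed.

Lemma bin_mean_id m z : bin_mean m (fun k => k%:R) z = m%:R * z.
Proof.
elim: m => [|m IH] /=; first by rewrite mul0r.
have -> : (GRing.natmul 1 \o S) = (fun k : nat => 1 * k%:R + 1 :> R).
  by apply/funext => k /=; rewrite mul1r -natr1.
by rewrite bin_mean_lin bin_mean_cst IH -natr1; ring.
Qed.

(** A mean that is not positive has such a value at some atom. The two implications say that [k] is
    an atom: only 0 is one when z = 0, and only m when z = 1. *)
Lemma bin_mean_le0 m f z : 0 <= z <= 1 -> bin_mean m f z <= 0 ->
  exists k, [/\ (k <= m)%N, (0 < k)%N -> 0 < z, (k < m)%N -> z < 1 & f k <= 0].
Proof.
move=> /andP[z0 z1]; elim: m f => [|m IH] f /=; first by exists 0%N.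
have [->|z_neq0] := eqVneq z 0.
  rewrite mul0r add0r subr0 mul1r => h; exists 0%N; split=> //.
  by elim: {IH} m h => //= m IH; rewrite mul0r add0r subr0 mul1r.
have zgt0 : 0 < z by rewrite lt_neqAle eq_sym z_neq0.
have [z_eq1|z_neq1] := eqVneq z 1.
  rewrite z_eq1 subrr mul0r addr0 mul1r => h; exists m.+1; split=> //.
    by rewrite ltnn.
  rewrite -[m.+1]/(S m) -[f _]/((f \o S) m); move: (f \o S) h.
  elim: {IH} m => //= m IH f'; rewrite subrr mul0r addr0 mul1r.
  exact: (IH (f' \o S)).
have zlt1 : z < 1 by rewrite lt_neqAle z_neq1.
move=> h.
have [h1|h1] := leP (bin_mean m (f \o S) z) 0.
  by have [k [km _ _ fk]] := IH _ h1; exists k.+1; split.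
have [h2|h2] := leP (bin_mean m f z) 0.
  by have [k [km _ _ fk]] := IH _ h2; exists k; split=> //; exact: ltnW.
suff : 0 < z * bin_mean m (f \o S) z + (1 - z) * bin_mean m f z.
  by rewrite ltNge h.
by rewrite addr_gt0// mulr_gt0// subr_gt0.
Qed.

End BinomialMean.

(** * One-step bound for the squared accumulated noise *)

Section OneStep.
Variable R : realType.

(** The noise is not centred, because the new denominator [D + dl c] depends on the same choice as
    [A c]. Its bias and its second moment are both of the order of the mean of 1/D - 1/(D + dl),
    which telescopes over time. The bound on [X] controls the cross term. *)
Lemma reset_step (I : finType) (w A dl : I -> R) (K D X : R) :
  (forall c, 0 <= w c) -> \sum_c w c = 1 ->
  (forall c, `|A c| <= dl c) -> (forall c, dl c <= K) -> 1 <= D -> `|X| <= 1 ->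
  \sum_c w c * (X + (A c / (D + dl c) - (\sum_e w e * A e) / D)) ^+ 2 <=
  X ^+ 2 + \sum_c w c * (2 * K * (K + 3) * (D^-1 - (D + dl c)^-1)).
Proof.
move=> w0 w1 Adl dlK D1 X1.
set E := \sum_e w e * A e.
have Dgt0 : 0 < D by lra.
have dl0 c : 0 <= dl c by rewrite (le_trans _ (Adl c)).
have Dd c : 0 < D + dl c by rewrite ltr_wpDr.
have [c0 _|I0] := pickP (fun _ : I => true); last first.
  by move: w1; rewrite big_pred0// => /esym/eqP; rewrite oner_eq0.
have K0 : 0 <= K by rewrite (le_trans (dl0 c0)).
set T := fun c => dl c / (D * (D + dl c)).
have TE c : D^-1 - (D + dl c)^-1 = T c.
  by rewrite /T; field; rewrite !gt_eqF.
have TdE c : T c = dl c / (D * (D + dl c)) by [].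
clearbody T.
have T0 c : 0 <= T c by rewrite TdE divr_ge0// mulr_ge0// ltW.
have Ed : `|E| <= \sum_c w c * dl c.
  rewrite (le_trans (ler_norm_sum _ _ _))//; apply: ler_sum => c _.
  by rewrite normrM ger0_norm// ler_wpM2l.
have dK : \sum_c w c * dl c <= K.
  rewrite -[K]mul1r -w1 mulr_suml; apply: ler_sum => c _.
  by rewrite ler_wpM2l.
(* (x - y)^2 <= 2 x^2 + 2 y^2 for the quadratic term; the linear term has mean
   - E (A dl / (D (D + dl))), which telescopes like 1/D. *)
have pw c : (X + (A c / (D + dl c) - E / D)) ^+ 2 <=
    X ^+ 2 + 2 * X * (A c - E) / D + 2 * K * T c + 2 * K * T c
      + 2 * (E ^+ 2 / D ^+ 2).
  have -> : A c / (D + dl c) = A c / D - A c * T c.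
    by rewrite TdE; field; rewrite ?gt_eqF.
  have h1 : - (2 * X * (A c * T c)) <= 2 * K * T c.
    rewrite (le_trans (ler_norm _))// normrN !normrM (ger0_norm (T0 c)).
    rewrite normr_nat !mulrA ler_wpM2r// -mulrA ler_wpM2l//.
    by rewrite -[leRHS]mul1r ler_pM// (le_trans (Adl c)).
  have h2 : (A c / D - A c * T c) ^+ 2 <= K * T c.
    have -> : A c / D - A c * T c = A c / (D + dl c).
      by rewrite TdE; field; rewrite ?gt_eqF.
    rewrite exprMn -[K * _]mulrC TdE.
    have : A c ^+ 2 <= dl c * K.
      rewrite -real_normK ?num_real// expr2.
      by rewrite ler_pM// (le_trans (Adl c)).
    have : (D + dl c) ^- 2 <= (D * (D + dl c))^-1.
      rewrite lef_pV2 ?posrE ?exprn_gt0 ?mulr_gt0// expr2 ler_wpM2r//.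
        exact: ltW.
      by rewrite lerDl.
    rewrite -exprVn => i1 i2.
    rewrite (mulrAC (dl c)); apply: ler_pM => //; exact: sqr_ge0.
  have : (X + (A c / D - A c * T c - E / D)) ^+ 2 =
     X ^+ 2 + 2 * X * (A c - E) / D - 2 * X * (A c * T c) +
     (A c / D - A c * T c - E / D) ^+ 2.
    by field; rewrite gt_eqF.
  move=> ->.
  have : (A c / D - A c * T c - E / D) ^+ 2 <=
     2 * (A c / D - A c * T c) ^+ 2 + 2 * (E ^+ 2 / D ^+ 2).
    rewrite -expr_div_n -subr_ge0; set x := A c / D - _; set y := E / D.
    have -> : 2 * x ^+ 2 + 2 * y ^+ 2 - (x - y) ^+ 2 = (x + y) ^+ 2 by ring.
    exact: sqr_ge0.
  by lra.
(* |E| is at most the mean of [dl] and also at most K, so E^2 is at most K times that mean; and dl /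
   D^2 = (1 + dl / D) T is at most (K + 1) T because D >= 1. *)
have last : E ^+ 2 / D ^+ 2 <= \sum_c w c * (K * (K + 1) * T c).
  apply: (@le_trans _ _ (K * (\sum_c w c * dl c) / D ^+ 2)).
    apply: ler_wpM2r; first by rewrite invr_ge0 exprn_ge0// ltW.
    rewrite -real_normK ?num_real// expr2 mulrC.
    by rewrite ler_pM// (le_trans Ed).
  rewrite mulr_sumr mulr_suml; apply: ler_sum => c _.
  have -> : K * (w c * dl c) / D ^+ 2 = w c * (K * (dl c / D ^+ 2)).
    by field; rewrite gt_eqF.
  rewrite ler_wpM2l// -mulrA ler_wpM2l//.
  have -> : dl c / D ^+ 2 = (1 + dl c / D) * T c.
    by rewrite TdE; field; rewrite ?gt_eqF.
  rewrite ler_wpM2r// addrC lerD2r.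
  rewrite ler_pdivrMr// (le_trans (dlK c))//.
  by rewrite -[leLHS]mulr1 ler_wpM2l.
apply: (@le_trans _ _ (\sum_c w c * (X ^+ 2 + 2 * X * (A c - E) / D
   + 2 * K * T c + 2 * K * T c + 2 * (E ^+ 2 / D ^+ 2)))).
  by apply: ler_sum => c _; rewrite ler_wpM2l.
have -> : \sum_c w c * (X ^+ 2 + 2 * X * (A c - E) / D
   + 2 * K * T c + 2 * K * T c + 2 * (E ^+ 2 / D ^+ 2)) =
  X ^+ 2 + \sum_c w c * (4 * K * T c) + 2 * (E ^+ 2 / D ^+ 2).
  transitivity (\sum_c (w c * (X ^+ 2 + 2 * (E ^+ 2 / D ^+ 2) - 2 * X * E / D) +
     w c * A c * (2 * X / D) + w c * (4 * K * T c))).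
    by apply: eq_bigr => c _; field; rewrite gt_eqF.
  rewrite !big_split /= -!mulr_suml w1 -/E; field; by rewrite gt_eqF.
have -> : \sum_c w c * (2 * K * (K + 3) * (D^-1 - (D + dl c)^-1)) =
  \sum_c w c * (4 * K * T c) + 2 * \sum_c w c * (K * (K + 1) * T c).
  rewrite mulr_sumr -big_split; apply: eq_bigr => c _ /=.
  rewrite TE; ring.
by lra.
Qed.

End OneStep.

(** * Deterministic recursions with summable noise *)

Section Deterministic.
Variable R : realType.

(** As long as [U] exceeds c + e, each step lowers it by at least e * a t, which cannot last since
    these rates have divergent sum. Once below c + e it stays there, since each step bounds it by a
    convex combination of its old value and c. *)
Lemma relax_le (U a : nat -> R) (c : R) (T0 : nat) :
  (forall t, (T0 <= t)%N -> 0 <= a t <= 1) ->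
  (forall B, exists n, B <= \sum_(T0 <= k < n) a k) ->
  (forall t, (T0 <= t)%N -> U t.+1 <= U t + a t * (c - U t)) ->
  forall e, 0 < e -> exists2 T, (T0 <= T)%N & forall t, (T <= t)%N -> U t <= c + e.
Proof.
move=> a01 adiv dyn e e0.
have [T T0T UT] : exists2 T, (T0 <= T)%N & U T <= c + e.
  apply: contrapT => noT.
  have UT t : (T0 <= t)%N -> c + e < U t.
    by move=> T0t; rewrite ltNge; apply/negP => Ut; apply: noT; exists t.
  have dec n : U (T0 + n)%N <= U T0 - e * \sum_(T0 <= k < T0 + n) a k.
    elim: n => [|n IH]; first by rewrite addn0 big_geq// mulr0 subr0.
    rewrite addnS big_nat_recr ?leq_addr//= (le_trans (dyn _ (leq_addr _ _)))//.
    have /andP[an0 _] := a01 _ (leq_addr n T0).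
    have : a (T0 + n)%N * (c - U (T0 + n)%N) <= a (T0 + n)%N * - e.
      by rewrite ler_wpM2l//; have := UT _ (leq_addr n T0); lra.
    by rewrite mulrDr; lra.
  have [n] := adiv ((U T0 - c) / e).
  have [T0n|/ltnW nT0] := leqP T0 n; last first.
    by rewrite big_geq// ler_pdivrMr// mul0r; have := UT _ (leqnn T0); lra.
  rewrite ler_pdivrMr// mulrC => h.
  have := dec (n - T0)%N; rewrite subnKC//; have := UT _ T0n; lra.
exists T => // t; elim: t => [|t IH]; first by rewrite leqn0 => /eqP <-.
rewrite leq_eqVlt => /predU1P[<-//|]; rewrite ltnS => Tt.
have T0t := leq_trans T0T Tt.
rewrite (le_trans (dyn _ T0t))//; have /andP[at0 at1] := a01 _ T0t.
have := IH Tt; rewrite -subr_ge0 => h; rewrite -subr_ge0.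
have -> : c + e - (U t + a t * (c - U t)) = (1 - a t) * (c + e - U t) + a t * e.
  by ring.
by rewrite addr_ge0// mulr_ge0// ?subr_ge0// ltW.
Qed.

Variables (I : finType) (Y a q xi : I -> nat -> R) (F : R -> R) (T0 : nat).
Hypothesis a01 : forall i t, (T0 <= t)%N -> 0 <= a i t <= 1.
Hypothesis F_homo : {homo F : x y / x <= y}.

(* The maximum of the Y i decreases: if M > z were the infimum of the eventual
   upper bounds, then F (q i) <= F (M + eta) < M would drive each Y i strictly
   below M. *)
Lemma eventually_le (z : R) :
  (forall i t, `|Y i t| <= 1) ->
  (forall x, z < x -> exists2 eta, 0 < eta & F (x + eta) <= x - eta) ->
  (forall i T B, exists n, B <= \sum_(T <= k < n) a i k) ->
  (forall i t, (T0 <= t)%N ->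
     Y i t.+1 = Y i t + a i t * (F (q i t) - Y i t) + xi i t) ->
  (forall i t x, (T0 <= t)%N -> (forall j, Y j t <= x) -> q i t <= x) ->
  (forall i e, 0 < e -> exists T, forall s t, (T <= s)%N -> (s <= t)%N ->
     `|\sum_(s <= k < t) xi i k| <= e) ->
  forall i e, 0 < e -> exists T, forall t, (T <= t)%N -> Y i t <= z + e.
Proof.
move=> Y1 Fz adiv dyn qle noise i0 e e0.
set S := [set x | exists T, forall t i, (T <= t)%N -> Y i t <= x].
have S1 : S 1.
  by exists 0%N => t i _; rewrite (le_trans (ler_norm _)).
have Slb : lbound S (-1).
  move=> x [T hT]; rewrite (le_trans _ (hT _ i0 (leqnn T)))//.
  by have := Y1 i0 T; rewrite ler_norml => /andP[].
have Sinf : has_inf S by split; [exists 1|exists (-1)].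
have near x : inf S < x -> S x.
  move=> Sx; have [] := @inf_adherent _ S (x - inf S) _ Sinf.
    by rewrite subr_gt0.
  move=> y [T hT]; rewrite addrC subrK => yx; exists T => t i Tt.
  by rewrite (le_trans (hT t i Tt))// ltW.
have [Sz|zS] := leP (inf S) z.
  have [T hT] : S (z + e) by apply: near; rewrite (le_lt_trans Sz)// ltrDl.
  by exists T => t Tt; exact: hT.
have [eta eta0 Feta] := Fz _ zS.
have [T1 hT1] : S (inf S + eta) by apply: near; rewrite ltrDl.
have ind i : exists T, forall t, (T <= t)%N -> Y i t <= inf S - eta / 2.
  have eta8 : 0 < eta / 8 by rewrite divr_gt0.
  have [T2 hT2] := noise i _ eta8.
  set T3 := maxn T0 (maxn T1 T2).
  have T03 : (T0 <= T3)%N by rewrite leq_max leqnn.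
  have T13 : (T1 <= T3)%N by rewrite !leq_max leqnn orbT.
  have T23 : (T2 <= T3)%N by rewrite !leq_max leqnn !orbT.
  (* Removing the noise accumulated since [T3] leaves a noiseless relaxation whose target is shifted
     by eta / 8. Two further errors of eta / 8 come from [relax_le] and from returning to [Y], so
     [Y] ends below inf S - 5 eta / 8. *)
  pose U t := Y i t - \sum_(T3 <= k < t) xi i k.
  have UY t : (T3 <= t)%N -> `|Y i t - U t| <= eta / 8.
    by move=> T3t; rewrite /U opprD opprK addrA subrr add0r; exact: hT2.
  have [||t T3t|T T3T hT] := @relax_le U (a i) (inf S - eta + eta / 8) T3 _ _ _
    _ eta8.
  - by move=> t T3t; apply: a01; rewrite (leq_trans T03).
  - exact: adiv.
  - have T0t := leq_trans T03 T3t.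
    rewrite /U big_nat_recr//= dyn//.
    have /andP[at0 _] := a01 i T0t.
    have qt : F (q i t) <= inf S - eta.
      rewrite (le_trans _ Feta)//; apply: F_homo; apply: qle => // j.
      by apply: hT1; rewrite (leq_trans T13).
    have := UY _ T3t; rewrite ler_norml => /andP[UY1 UY2].
    have : a i t * (F (q i t) - Y i t) <= a i t * (inf S - eta + eta / 8 - U t).
      by apply: ler_wpM2l => //; lra.
    rewrite /U; lra.
  - exists T => t Tt; have := hT _ Tt.
    have := UY _ (leq_trans T3T Tt); rewrite ler_norml => /andP[_].
    lra.
have [Tf hTf] := choice ind.
have : S (inf S - eta / 2).
  exists (\max_i Tf i) => t i Tt; apply: hTf; rewrite (leq_trans _ Tt)//.
  exact: leq_bigmax.
move=> /(ge_inf (proj2 Sinf)); lra.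
Qed.

(** With the accumulated noise removed, the new value is a convex combination of the old one and of
    F (q) minus that noise; the margin e in the hypotheses on [F] absorbs the noise, so [l, u] is
    invariant. The recursion is only assumed inside the enlarged interval, which the same induction
    guarantees. *)
Lemma barrier (l u e : R) :
  F (u + e) + e <= u -> l <= F (l - e) - e ->
  (forall i, l <= Y i T0 <= u) ->
  (forall i t, (T0 <= t)%N -> (forall j, l - e <= Y j t <= u + e) ->
     Y i t.+1 = Y i t + a i t * (F (q i t) - Y i t) + xi i t) ->
  (forall i t x, (T0 <= t)%N -> (forall j, Y j t <= x) -> q i t <= x) ->
  (forall i t x, (T0 <= t)%N -> (forall j, x <= Y j t) -> x <= q i t) ->
  (forall i t, (T0 <= t)%N -> `|\sum_(T0 <= k < t) xi i k| <= e) ->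
  forall i t, (T0 <= t)%N -> l - e <= Y i t <= u + e.
Proof.
move=> Fu Fl init dyn qle qge noise.
pose U i t := Y i t - \sum_(T0 <= k < t) xi i k.
have UY i t : (T0 <= t)%N -> `|Y i t - U i t| <= e.
  by move=> T0t; rewrite /U opprD opprK addrA subrr add0r; exact: noise.
have Uin t : (T0 <= t)%N -> forall i, l <= U i t <= u.
  elim: t => [|t IH].
    by rewrite leqn0 => /eqP T00 i; rewrite /U big_geq// subr0 -[0%N]T00.
  rewrite leq_eqVlt => /predU1P[<- i|]; first by rewrite /U big_geq// subr0.
  rewrite ltnS => T0t i.
  have Yin j : l - e <= Y j t <= u + e.
    have := UY j _ T0t; rewrite ler_norml => /andP[UY1 UY2].
    by have /andP[? ?] := IH T0t j; apply/andP; split; lra.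
  have Fq1 : F (q i t) <= u - e.
    rewrite (@le_trans _ _ (F (u + e)))//; last lra.
    by apply: F_homo; apply: qle => // j; have /andP[] := Yin j.
  have Fq2 : l + e <= F (q i t).
    rewrite (@le_trans _ _ (F (l - e)))//; first lra.
    by apply: F_homo; apply: qge => // j; have /andP[] := Yin j.
  rewrite /U big_nat_recr//= dyn//.
  have := UY i _ T0t; rewrite ler_norml => /andP[UY1 UY2].
  have /andP[U1 U2] := IH T0t i.
  have /andP[at0 at1] := a01 i T0t.
  have -> : Y i t + a i t * (F (q i t) - Y i t) + xi i t -
     (\sum_(T0 <= k < t) xi i k + xi i t) =
     (1 - a i t) * U i t + a i t * (F (q i t) - (Y i t - U i t)).
    by rewrite /U; ring.
  have at1' : 0 <= 1 - a i t by rewrite subr_ge0.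
  apply/andP; split.
    apply: (@le_trans _ _ ((1 - a i t) * l + a i t * l)); first by lra.
    by apply: lerD; apply: ler_wpM2l => //; lra.
  apply: (@le_trans _ _ ((1 - a i t) * u + a i t * u)); last by lra.
  by apply: lerD; apply: ler_wpM2l => //; lra.
move=> i t T0t; have := UY i _ T0t; rewrite ler_norml => /andP[UY1 UY2].
by have /andP[? ?] := Uin _ T0t i; apply/andP; split; lra.
Qed.

End Deterministic.

(** * Degrees in a growing graph *)

Section WeightedDegree.
Variable N : nat.
Implicit Types (g : mgraph N) (phi : pred ('I_N * bool)) (i : 'I_N).

(** Selecting vertices by a predicate on labels lets one growth formula serve both the total and the
    red degree of a community. *)
Definition wdeg g phi : nat :=
  (\sum_(v : 'I_(nv g) | phi (tnth (in_tuple g.1) v)) deg v)%N.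

Definition comm_deg g i := wdeg g (fun l => l.1 == i).

Definition red_deg g i := wdeg g (fun l => l.2 && (l.1 == i)).

Definition edges_in g :=
  forall e, e \in g.2 -> (e.1 < nv g)%N && (e.2 < nv g)%N.

(** Indexed by naturals, since the ordinal type of the vertices changes when the graph grows. *)
Definition has_label g phi (k : nat) : bool :=
  nth false [seq phi l | l <- g.1] k.

Lemma has_label_ord g phi (v : 'I_(nv g)) :
  has_label g phi v = phi (tnth (in_tuple g.1) v).
Proof.
have x0 : 'I_N * bool by exact: tnth (in_tuple g.1) v.
by rewrite /has_label (nth_map x0) // (tnth_nth x0).
Qed.

(** Double counting of edge-ends. The edge form is additive when edges are appended, which yields
    [wdeg_add]. *)
Lemma wdegE g phi : edges_in g ->
  wdeg g phi = (\sum_(e <- g.2) (has_label g phi e.1 + has_label g phi e.2))%N.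
Proof.
move=> gE; rewrite /wdeg big_mkcond /=.
under eq_bigr do rewrite -has_label_ord.
rewrite /deg.
transitivity (\sum_(e <- g.2) \sum_(v < nv g)
   (has_label g phi v * (e.1 == v) + has_label g phi v * (e.2 == v)))%N.
  rewrite exchange_big /=; apply: eq_bigr => v _.
  case: has_label; last by rewrite big1.
  by apply: eq_bigr => e _; rewrite !mul1n.
apply: eq_big_seq => e /gE /andP[e1 e2]; rewrite big_split /=.
have pick k : (k < nv g)%N ->
    (\sum_(v < nv g) has_label g phi v * (k == v) = has_label g phi k)%N.
  move=> kn; rewrite (bigD1 (Ordinal kn)) //= eqxx muln1 big1 ?addn0 // => v.
  by rewrite -val_eqE /= eq_sym => /negbTE ->; rewrite muln0.
by rewrite !pick.
Qed.

Lemma wdeg_le g phi : edges_in g -> (wdeg g phi <= 2 * size g.2)%N.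
Proof.
move=> gE; rewrite wdegE //; elim: (g.2) => [|e s IH]; first by rewrite big_nil.
by rewrite big_cons /= mulnS leq_add //; do 2 case: has_label.
Qed.

Section AddVertex.
Variables (m : nat) (g : mgraph N) (y : 'I_N) (s : m.-tuple 'I_(nv g)).
Variable b : bool.
Let g' := add_vertex y s b.

Lemma nv_add : nv g' = (nv g).+1.
Proof. by rewrite /nv /= size_rcons. Qed.

Lemma edges_in_add : edges_in g -> edges_in g'.
Proof.
move=> gE e; rewrite nv_add /= mem_cat => /orP[/gE /andP[e1 e2]|].
  by rewrite !ltnS (ltnW e1) (ltnW e2).
by move=> /mapP[v _ ->] /=; rewrite !ltnS leqnn (ltnW (ltn_ord v)).
Qed.

Lemma wdeg_add phi : edges_in g ->
  wdeg g' phi = (wdeg g phi + (m * phi (y, b) +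
    \sum_(v <- s) phi (tnth (in_tuple g.1) v)))%N.
Proof.
move=> gE; have gE' := edges_in_add gE; rewrite !wdegE // big_cat /=.
have old k : (k < nv g)%N -> has_label g' phi k = has_label g phi k.
  by move=> kn; rewrite /has_label /= map_rcons nth_rcons size_map kn.
congr (_ + _)%N.
  by apply: eq_big_seq => e /gE /andP[e1 e2]; rewrite !old.
rewrite big_map /=.
have -> : has_label g' phi (nv g) = phi (y, b).
  by rewrite /has_label /= map_rcons nth_rcons size_map ltnn eqxx.
rewrite big_split /= big_const_seq count_predT size_tuple iter_addn_0 mulnC.
by congr (_ + _)%N; apply: eq_bigr => v _; rewrite old // has_label_ord.
Qed.

End AddVertex.

Lemma wdeg_ge_deg g phi (v : 'I_(nv g)) :
  phi (tnth (in_tuple g.1) v) -> (deg v <= wdeg g phi)%N.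
Proof. by move=> phiv; rewrite /wdeg (bigD1 v) //= leq_addr. Qed.

Lemma red_prop_wdeg (R : realType) g i :
  red_prop R g i = (red_deg g i)%:R / (comm_deg g i)%:R.
Proof. by rewrite /red_prop /red_deg /comm_deg /wdeg !natr_sum. Qed.

Lemma red_deg_le g i : (red_deg g i <= comm_deg g i)%N.
Proof.
rewrite /red_deg /comm_deg /wdeg [leqRHS](bigID (fun v => red v)) /=.
rewrite -[leqLHS]addn0 leq_add // leq_eqVlt; apply/orP; left; apply/eqP.
by apply: eq_bigl => v; rewrite andbC.
Qed.

(** The consequences of [initial_graph] that serve as the invariant of the growth. *)
Definition regular (m : nat) g :=
  [/\ edges_in g, size g.2 = (m * nv g)%N & forall i, (0 < comm_deg g i)%N].

Lemma regular_initial m g : initial_graph g m -> regular m g.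
Proof.
case=> gs gE gdeg gcomm; split => // i; have [v <-] := gcomm i.
by rewrite (leq_trans (gdeg v)) // wdeg_ge_deg // eqxx.
Qed.

Lemma regular_add m g y (s : m.-tuple 'I_(nv g)) b :
  regular m g -> regular m (add_vertex y s b).
Proof.
move=> [gE gs gcomm]; split; first exact: edges_in_add.
  by rewrite nv_add /= size_cat gs size_map size_tuple mulnS addnC.
by move=> i; rewrite /comm_deg wdeg_add // addn_gt0 [X in X || _]gcomm.
Qed.

Lemma comm_deg_le m g i : regular m g -> (comm_deg g i <= 2 * m * nv g)%N.
Proof. by case=> gE gs _; rewrite -mulnA -gs wdeg_le. Qed.

End WeightedDegree.

(** * Independent draws with replacement *)

Section TupleSum.
Variables (R : realType) (T : finType) (att : T -> R).

Lemma sum_tupleS n (F : n.+1.-tuple T -> R) :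
  \sum_(s : n.+1.-tuple T) F s =
  \sum_v \sum_(s : n.-tuple T) F (cons_tuple v s).
Proof.
rewrite pair_big /=.
rewrite (reindex (fun vs : T * n.-tuple T => cons_tuple vs.1 vs.2)) //=.
exists (fun s => (thead s, behead_tuple s)) => [[v s] _|s _] /=.
  by congr pair; apply: val_inj.
by rewrite [RHS]tuple_eta; apply: val_inj.
Qed.

Lemma sum_tuple0 (F : 0.-tuple T -> R) :
  \sum_(s : 0.-tuple T) F s = F (nil_tuple T).
Proof.
rewrite (bigD1 (nil_tuple T)) //= big1 ?addr0 // => s.
by rewrite [s]tuple0 => /eqP[]; apply: val_inj.
Qed.

Hypothesis att1 : \sum_v att v = 1.

Lemma sum_tuple_prob n : \sum_(s : n.-tuple T) \prod_(v <- s) att v = 1.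
Proof.
elim: n => [|n IH]; first by rewrite sum_tuple0 big_nil.
rewrite sum_tupleS -[RHS]att1; apply: eq_bigr => v _.
under eq_bigr => s _ do rewrite big_cons.
by rewrite -mulr_sumr IH mulr1.
Qed.

Lemma sum_tuple_mean n (f : T -> R) :
  \sum_(s : n.-tuple T) (\prod_(v <- s) att v) * (\sum_(v <- s) f v) =
  n%:R * \sum_v att v * f v.
Proof.
elim: n => [|n IH]; first by rewrite sum_tuple0 !big_nil mul0r mulr0.
rewrite sum_tupleS.
under eq_bigr => v _.
  under eq_bigr => s _ do rewrite !big_cons -mulrA mulrDr mulrDr.
  rewrite big_split /= -!mulr_sumr -mulr_suml sum_tuple_prob mul1r IH.
  over.
by rewrite big_split /= -mulr_suml att1 mul1r -natr1 mulrDl mul1r addrC.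
Qed.

(** The number of draws falling in [a] is binomial: splitting on whether the first draw lies in [a]
    reproduces the recursion of [bin_mean]. *)
Lemma sum_tuple_count n (a : pred T) (h : nat -> R) :
  \sum_(s : n.-tuple T) (\prod_(v <- s) att v) * h (count a s) =
  bin_mean n h (\sum_(v | a v) att v).
Proof.
elim: n h => [|n IH] h; first by rewrite sum_tuple0 big_nil mul1r.
rewrite sum_tupleS (bigID a) /=.
have -> : 1 - \sum_(v | a v) att v = \sum_(v | ~~ a v) att v.
  by rewrite -att1 (bigID a) /= [LHS]addrAC subrr add0r.
rewrite -IH -[bin_mean n h _]IH !mulr_suml; congr (_ + _); apply: eq_bigr => v av.
  by rewrite mulr_sumr; apply: eq_bigr => s _; rewrite big_cons /= av mulrA.
rewrite mulr_sumr; apply: eq_bigr => s _.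
by rewrite big_cons /= (negbTE av) mulrA.
Qed.

End TupleSum.

(** * One step of the process *)

Section Kernel.
Variables (R : realType) (N m : nat).
Variables (mu : 'I_N -> R) (alpha : 'M[R]_N) (p : nat -> R).
Hypothesis mu_gt0 : forall i, 0 < mu i.
Hypothesis mu_sum1 : \sum_i mu i = 1.
Hypothesis alpha_ge0 : forall x y, 0 <= alpha x y.
Hypothesis alpha_col_gt0 : forall y, 0 < \sum_x alpha x y.
Hypothesis p_prob : forall k, (k <= m)%N -> 0 <= p k <= 1.
Implicit Types (g : mgraph N) (y i : 'I_N).

(** A transition is a newcomer's community, its neighbours and its colour; the type is finite, so
    conditional expectations are finite sums against [weight]. *)
Definition choice_at g : finType := ('I_N * m.-tuple 'I_(nv g) * bool)%type.

Definition weight g (c : choice_at g) : R := step_prob mu alpha p c.1.1 c.1.2 c.2.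

Definition grow g (c : choice_at g) : mgraph N := add_vertex c.1.1 c.1.2 c.2.

Definition red_prob g y : R :=
  \sum_(v : 'I_(nv g) | red v) attach_prob alpha y v.

Lemma sum_comm g (P : pred 'I_(nv g)) (f : 'I_N -> R) :
  \sum_(v : 'I_(nv g) | P v) f (comm v) * (deg v)%:R =
  \sum_j f j * (\sum_(v : 'I_(nv g) | P v && (comm v == j)) deg v)%:R.
Proof.
rewrite (partition_big (@comm N g) xpredT) //=; apply: eq_bigr => j _.
by rewrite natr_sum mulr_sumr; apply: eq_bigr => v /andP[_ /eqP <-].
Qed.

Definition attach_total g y : R :=
  \sum_(u : 'I_(nv g)) alpha (comm u) y * (deg u)%:R.

Lemma attach_totalE g y :
  attach_total g y = \sum_j alpha j y * (comm_deg g j)%:R.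
Proof. exact: sum_comm. Qed.

Lemma red_probE g y :
  red_prob g y = (\sum_j alpha j y * (red_deg g j)%:R) / attach_total g y.
Proof.
rewrite /red_prob /attach_prob -mulr_suml (@sum_comm g (@red N g) (alpha^~ y)).
exact: erefl.
Qed.

Section Regular.
Variable g : mgraph N.
Hypothesis g_reg : regular m g.

Lemma comm_deg_gt0 i : 0 < (comm_deg g i)%:R :> R.
Proof. by case: g_reg => _ _ h; rewrite ltr0n. Qed.

Lemma attach_total_gt0 y : 0 < attach_total g y.
Proof.
rewrite attach_totalE lt_neqAle eq_sym sumr_ge0 ?andbT; last first.
  by move=> j _; rewrite mulr_ge0.
apply: contraTneq (alpha_col_gt0 y) => /eqP.
rewrite psumr_eq0 => [|j _]; last by rewrite mulr_ge0.
move=> /allP h; rewrite -leNgt big1 // => j _; apply/eqP.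
have := h j (mem_index_enum _); rewrite /= mulf_eq0.
by rewrite (gt_eqF (comm_deg_gt0 j)) orbF.
Qed.

Lemma attach_prob_ge0 y (v : 'I_(nv g)) : 0 <= attach_prob alpha y v.
Proof. by rewrite divr_ge0 ?mulr_ge0 // ltW // attach_total_gt0. Qed.

Lemma attach_prob_sum1 y : \sum_(v : 'I_(nv g)) attach_prob alpha y v = 1.
Proof. by rewrite -mulr_suml divff // gt_eqF // attach_total_gt0. Qed.

Lemma nb_red_le (s : m.-tuple 'I_(nv g)) : (nb_red s <= m)%N.
Proof. by rewrite /nb_red (leq_trans (count_size _ _)) // size_tuple. Qed.

Lemma weight_ge0 (c : choice_at g) : 0 <= weight c.
Proof.
have /andP[p0 p1] := p_prob (nb_red_le c.1.2).
rewrite /weight /step_prob !mulr_ge0 //; first exact: ltW.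
  by apply: prodr_ge0 => v _; exact: attach_prob_ge0.
by case: ifP; rewrite ?subr_ge0.
Qed.

Lemma sum_weight (F : 'I_N -> m.-tuple 'I_(nv g) -> bool -> R) :
  \sum_(c : choice_at g) weight c * F c.1.1 c.1.2 c.2 =
  \sum_y mu y * \sum_(s : m.-tuple 'I_(nv g)) (\prod_(v <- s) attach_prob alpha y v)
    * (p (nb_red s) * F y s true + (1 - p (nb_red s)) * F y s false).
Proof.
under [RHS]eq_bigr do rewrite mulr_sumr.
rewrite pair_big /=.
under [RHS]eq_bigr => ys _.
  rewrite -(big_bool _ (fun b => (if b then p (nb_red ys.2) else 1 - p (nb_red ys.2))
     * F ys.1 ys.2 b)) !mulr_sumr; over.
rewrite pair_big /=; apply: eq_bigr => c _.
by rewrite /weight /step_prob !mulrA.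
Qed.

Lemma weight_sum1 : \sum_(c : choice_at g) weight c = 1.
Proof.
have := sum_weight (fun _ _ _ => 1); under eq_bigr do rewrite mulr1.
move=> ->; rewrite -[RHS]mu_sum1; apply: eq_bigr => y _.
under eq_bigr do rewrite !mulr1 addrC subrK mulr1.
by rewrite sum_tuple_prob ?mulr1 // attach_prob_sum1.
Qed.

(** [red_prob g y] averages the red proportions with weights proportional to [alpha j y] times the
    degree of community j. *)
Lemma red_prob_le y x : (forall j, red_prop R g j <= x) -> red_prob g y <= x.
Proof.
move=> Zx; rewrite red_probE ler_pdivrMr ?attach_total_gt0 // attach_totalE.
rewrite mulr_sumr; apply: ler_sum => j _; rewrite mulrCA ler_wpM2l //.
by rewrite -ler_pdivrMr ?comm_deg_gt0 // -red_prop_wdeg.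
Qed.

Lemma red_prob_ge y x : (forall j, x <= red_prop R g j) -> x <= red_prob g y.
Proof.
move=> Zx; rewrite red_probE ler_pdivlMr ?attach_total_gt0 // attach_totalE.
rewrite mulr_sumr; apply: ler_sum => j _; rewrite mulrCA ler_wpM2l //.
by rewrite -ler_pdivlMr ?comm_deg_gt0 // -red_prop_wdeg.
Qed.

Lemma red_prop_01 i : 0 <= red_prop R g i <= 1.
Proof.
rewrite red_prop_wdeg divr_ge0 //= ler_pdivrMr ?comm_deg_gt0 // mul1r ler_nat.
exact: red_deg_le.
Qed.

Variable i : 'I_N.

Definition comm_gain (c : choice_at g) : nat :=
  (m * (c.1.1 == i) + \sum_(v <- c.1.2) (comm v == i))%N.

Definition red_gain (c : choice_at g) : nat :=
  (m * (c.2 && (c.1.1 == i)) + \sum_(v <- c.1.2) (red v && (comm v == i)))%N.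

Lemma comm_deg_grow c : comm_deg (grow c) i = (comm_deg g i + comm_gain c)%N.
Proof. by case: g_reg => gE _ _; rewrite /comm_deg wdeg_add. Qed.

Lemma red_deg_grow c : red_deg (grow c) i = (red_deg g i + red_gain c)%N.
Proof. by case: g_reg => gE _ _; rewrite /red_deg wdeg_add. Qed.

Lemma comm_gain_le c : (comm_gain c <= 2 * m)%N.
Proof.
rewrite mul2n -addnn leq_add //; first by rewrite -[leqRHS]muln1 leq_mul2l leq_b1 orbT.
apply: (@leq_trans (\sum_(v <- c.1.2) 1)); last by rewrite sum1_size size_tuple.
by apply: leq_sum => v _; exact: leq_b1.
Qed.

Lemma red_gain_le c : (red_gain c <= comm_gain c)%N.
Proof.
rewrite leq_add //; first by rewrite leq_mul2l; case: c.2; rewrite ?leqnn ?orbT.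
by apply: leq_sum => v _; case: red.
Qed.

Let Z := red_prop R g i.

(** The numerator of the change of proportion: divided by the new degree of the community, it is the
    increment of [red_prop]. *)
Definition excess c : R := (red_gain c)%:R - Z * (comm_gain c)%:R.

Lemma excess_norm c : `|excess c| <= (comm_gain c)%:R.
Proof.
have /andP[Z0 Z1] := red_prop_01 i.
have : (red_gain c)%:R <= (comm_gain c)%:R :> R by rewrite ler_nat red_gain_le.
have : Z * (comm_gain c)%:R <= 1 * (comm_gain c)%:R by rewrite ler_wpM2r.
have : 0 <= Z * (comm_gain c)%:R by rewrite mulr_ge0.
have : 0 <= (red_gain c)%:R :> R by [].
by rewrite /excess mul1r ler_norml; move=> *; apply/andP; split; lra.
Qed.

(* Attaching to the community does not change its proportion on average: only
   the new vertex itself contributes to the drift. *)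
Lemma excess_mean :
  \sum_(c : choice_at g) weight c * excess c =
  m%:R * mu i * ((rule_poly m p).[red_prob g i] - Z).
Proof.
pose old (s : m.-tuple 'I_(nv g)) : R :=
  \sum_(v <- s) (comm v == i)%:R * ((red v)%:R - Z).
pose F y (s : m.-tuple 'I_(nv g)) (b : bool) : R :=
  m%:R * (y == i)%:R * (b%:R - Z) + old s.
transitivity (\sum_(c : choice_at g) weight c * F c.1.1 c.1.2 c.2).
  apply: eq_bigr => c _; congr (_ * _); rewrite /excess /red_gain /comm_gain /F.
  rewrite !natrD !natrM !natr_sum mulrDr opprD addrACA; congr (_ + _).
    by rewrite -mulnb natrM; ring.
  rewrite mulr_sumr -sumrB; apply: eq_bigr => v _.
  by rewrite -mulnb natrM; ring.
rewrite sum_weight.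
(* Inside community i the attachment probabilities are proportional to degrees, so a neighbour
   chosen there is red with conditional probability exactly Z. *)
have old0 y : \sum_(s : m.-tuple 'I_(nv g))
    (\prod_(v <- s) attach_prob alpha y v) * old s = 0.
  rewrite sum_tuple_mean ?attach_prob_sum1 //.
  suff -> : \sum_(v : 'I_(nv g)) attach_prob alpha y v *
      ((comm v == i)%:R * ((red v)%:R - Z)) = 0 by rewrite mulr0.
  transitivity (alpha i y / attach_total g y *
      ((red_deg g i)%:R - Z * (comm_deg g i)%:R)); last first.
    rewrite /Z red_prop_wdeg divfK ?subrr ?mulr0 //.
    by rewrite gt_eqF ?comm_deg_gt0.
  rewrite /red_deg /comm_deg /wdeg !natr_sum.
  rewrite [X in X - _]big_mkcond [X in Z * X]big_mkcond /=.
  rewrite mulr_sumr -sumrB mulr_sumr; apply: eq_bigr => v _.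
  rewrite /attach_prob -/(attach_total g y) -/(comm v) -/(red v).
  by case: eqP => [->|_]; case: red; rewrite /= ; ring.
have e y : \sum_(s : m.-tuple 'I_(nv g)) (\prod_(v <- s) attach_prob alpha y v) *
    (p (nb_red s) * F y s true + (1 - p (nb_red s)) * F y s false) =
    m%:R * (y == i)%:R * ((rule_poly m p).[red_prob g y] - Z).
  transitivity (\sum_(s : m.-tuple 'I_(nv g))
     (m%:R * (y == i)%:R * ((\prod_(v <- s) attach_prob alpha y v) * p (nb_red s)) -
      m%:R * (y == i)%:R * Z * (\prod_(v <- s) attach_prob alpha y v) +
      (\prod_(v <- s) attach_prob alpha y v) * old s)).
    by apply: eq_bigr => s _; rewrite /F /=; ring.
  rewrite big_split big_split /= sumrN -!mulr_sumr old0 addr0.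
  rewrite sum_tuple_prob ?attach_prob_sum1 // sum_tuple_count ?attach_prob_sum1 //.
  by rewrite rule_polyE; ring.
under eq_bigr do rewrite e.
rewrite (bigD1 i) //= eqxx big1 ?addr0; first by rewrite mulr1 mulrCA mulrA.
by move=> y /negbTE ->; rewrite !(mulr0, mul0r).
Qed.

End Regular.

End Kernel.

(** * Trajectories and noise *)

(** Disjoint subsets of [B] with the total mass of [B] cover it up to a null set. The law of the
    process gives only the masses of the continuations of a cylinder, not that they exhaust it. *)
Lemma le_measure_cover d (T : measurableType d) (R : realType)
    (P : probability T R) (I : finType) (A : I -> set T) (B E : set T) :
  (forall i, measurable (A i)) -> measurable B -> measurable E ->
  (forall i j, i != j -> A i `&` A j = set0) -> (forall i, A i `<=` B) ->
  (\sum_i P (A i) = P B)%E -> (P (B `&` E) <= \sum_i P (A i `&` E))%E.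
Proof.
move=> mA mB mE Adisj AB AP.
have add (F : I -> set T) (s : seq I) : uniq s -> (forall i, measurable (F i)) ->
    (forall i j, i != j -> F i `&` F j = set0) ->
    measurable (\big[setU/set0]_(i <- s) F i) /\
    P (\big[setU/set0]_(i <- s) F i) = (\sum_(i <- s) P (F i))%E.
  move=> + mF Fdisj; elim: s => [_|i s IH /= /andP[is_ us]].
    by rewrite !big_nil measure0.
  have [mU PU] := IH us; rewrite !big_cons; split; first exact: measurableU.
  rewrite -PU; apply: measureU => //.
  rewrite -bigcup_seq setI_bigcupr bigcup0 // => j /= js; apply: Fdisj.
  by apply: contraNneq is_ => ->.
have [mU PU] := add A _ (index_enum_uniq I) mA Adisj.
have [mV PV] : measurable (\big[setU/set0]_i (A i `&` E)) /\
    P (\big[setU/set0]_i (A i `&` E)) = (\sum_i P (A i `&` E))%E.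
  apply: add => [|i|i j ij]; first exact: index_enum_uniq.
    exact: measurableI.
  by rewrite setIACA Adisj // set0I.
rewrite -PV.
set U := \big[setU/set0]_i A i in mU PU *.
have UB : U `<=` B by rewrite /U -bigcup_seq; apply: bigcup_sub => i _.
have PBU : P (B `\` U) = 0%E.
  have -> : P (B `\` U) = (P B - P U)%E.
    by rewrite -[in RHS](setIidr UB); apply: measureD; rewrite // ltey_eq fin_num_measure.
  by rewrite PU AP subee // fin_num_measure.
rewrite -[leRHS](measureU0 mV (measurableD mB mU) PBU).
apply: le_measure; rewrite ?inE.
- exact: measurableI.
- by apply: measurableU => //; exact: measurableD.
- move=> w [Bw Ew]; have [Uw|nUw] := pselect (U w); last by right.
  left; move: Uw; rewrite /U -!bigcup_seq => -[i si Aw].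
  by exists i.
Qed.

Lemma grow_inj N m (g : mgraph N) :
  injective (fun c : choice_at m g => grow c).
Proof.
move=> [[y s] b] [[y' s'] b'] [] /rcons_inj[-> ->] /eqP.
rewrite eqseq_cat // eqxx /= => /eqP/inj_map h; congr (_, _, _); apply: val_inj.
by apply: h => v v' [] /val_inj.
Qed.

Section Process.
Variables (R : realType) (d : measure_display) (T : measurableType d).
Variables (P : probability T R) (N m : nat) (mu : 'I_N -> R) (alpha : 'M[R]_N).
Variables (p : nat -> R) (g0 : mgraph N) (G : nat -> T -> mgraph N).
Hypothesis mu_gt0 : forall i, 0 < mu i.
Hypothesis mu_sum1 : \sum_i mu i = 1.
Hypothesis alpha_ge0 : forall x y, 0 <= alpha x y.
Hypothesis alpha_col_gt0 : forall y, 0 < \sum_x alpha x y.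
Hypothesis p_prob : forall k, (k <= m)%N -> 0 <= p k <= 1.
Hypothesis g0_init : initial_graph g0 m.
Hypothesis G_pa : pa_process m mu alpha p P g0 G.

Local Notation traj := (nat -> mgraph N).
Implicit Types (h : traj) (t n : nat).

Definition path_of (w : T) : traj := fun k => G k w.

Definition cylinder t h : set T := [set w | forall k, (k <= t)%N -> G k w = h k].

(** Only the value at [t.+1] matters; the constant tail keeps the trajectory total. *)
Definition extend t h (g : mgraph N) : traj := fun k => if (k <= t)%N then h k else g.

(** Adaptedness to the history up to time t, stated without a filtration. *)
Definition depends_upto (U : Type) t (Q : traj -> U) :=
  forall h h', (forall k, (k <= t)%N -> h k = h' k) -> Q h = Q h'.

Lemma measurable_cylinder t h : measurable (cylinder t h).
Proof.
case: G_pa => mG _ _.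
have -> : cylinder t h = \bigcap_(k in [set k | (k <= t)%N]) [set w | G k w = h k].
  by apply/seteqP; split.
by apply: bigcap_measurableType => k _; exact: mG.
Qed.

(** Histories up to time t form a countable set, so the event is a countable union of cylinders. *)
Lemma measurable_path t (Q : traj -> Prop) :
  depends_upto t Q -> measurable [set w | Q (path_of w)].
Proof.
move=> Qt.
(* The type of graphs is unfolded here so that its countability can be inferred. *)
pose past w : seq (seq ('I_N * bool) * seq (nat * nat)) :=
  [seq G k w | k <- iota 0 t.+1].
pose F (l : seq (seq ('I_N * bool) * seq (nat * nat))) : set T :=
  [set w | past w = l /\ Q (nth g0 l)].
have nth_past w k : (k <= t)%N -> nth g0 (past w) k = G k w.
  by move=> kt; rewrite (nth_map 0%N) ?size_iota // nth_iota.
have -> : [set w | Q (path_of w)] = \bigcup_l F l.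
  apply/seteqP; split => [w Qw|w [l _ [<- Ql]]] /=.
    exists (past w) => //; split=> //.
    by rewrite (Qt _ (path_of w)) // => k kt; rewrite nth_past.
  by rewrite (Qt _ (nth g0 (past w))) // => k kt; rewrite nth_past.
apply: countable_bigcupT_measurable; first exact: countableP.
move=> l; have [Ql|nQl] := pselect (Q (nth g0 l)); last first.
  by rewrite (_ : F l = set0) //; apply/seteqP; split=> [w []|].
have [sl|sl] := eqVneq (size l) t.+1; last first.
  rewrite (_ : F l = set0) //; apply/seteqP; split=> [w [pl _]|//].
  by move: sl; rewrite -pl size_map size_iota eqxx.
rewrite (_ : F l = cylinder t (nth g0 l)); first exact: measurable_cylinder.
apply/seteqP; split=> [w [<- _] k kt|w Gw].
  by rewrite nth_past.
split=> //; apply: (@eq_from_nth _ g0) => [|k]; rewrite size_map size_iota // => kt.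
by rewrite nth_past // Gw.
Qed.

Lemma cylinder_extend t h g :
  cylinder t.+1 (extend t h g) = cylinder t h `&` [set w | G t.+1 w = g].
Proof.
apply/seteqP; split=> [w Gw|w [Gw Gtw] k].
  split=> [k kt|/=]; first by rewrite Gw ?leqW // /extend kt.
  by rewrite Gw // /extend ltnn.
rewrite leq_eqVlt => /predU1P[->|]; first by rewrite Gtw /extend ltnn.
by rewrite ltnS /extend => kt; rewrite kt Gw.
Qed.

Lemma prob_cylinder_extend t h (c : choice_at m (h t)) :
  P (cylinder t.+1 (extend t h (grow c))) =
  (P (cylinder t h) * (weight mu alpha p c)%:E)%E.
Proof. by case: G_pa => _ _ GP; rewrite cylinder_extend GP. Qed.

Lemma le_prob_cylinder t h (E : set T) : regular m (h t) -> measurable E ->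
  (P (cylinder t h `&` E) <=
   \sum_(c : choice_at m (h t)) P (cylinder t.+1 (extend t h (grow c)) `&` E))%E.
Proof.
move=> h_reg mE; apply: le_measure_cover => //.
- by move=> c; exact: measurable_cylinder.
- exact: measurable_cylinder.
- move=> c c' cc'; apply/seteqP; split=> // w; rewrite !cylinder_extend.
  move=> [[_ /= ->] [_ /= /grow_inj c_eq]].
  by rewrite c_eq eqxx in cc'.
- by move=> c; rewrite cylinder_extend; exact: subIsetl.
- under eq_bigr do rewrite prob_cylinder_extend.
  have /fineK <- : P (cylinder t h) \is a fin_num.
    by apply: fin_num_measure; exact: measurable_cylinder.
  under eq_bigr do rewrite -EFinM.
  by rewrite sumEFin -mulr_sumr weight_sum1 ?mulr1.
Qed.

(** Markov's inequality for a nonnegative supermartingale, conditionally on a cylinder. Induction on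
    the remaining time, splitting by the next graph, replaces conditional expectations. *)
Lemma supermartingale_bound (V : nat -> traj -> R) t0 :
  (forall t, (t0 <= t)%N -> depends_upto t (V t)) ->
  (forall t h, regular m (h t) -> 0 <= V t h) ->
  (forall t h, (t0 <= t)%N -> regular m (h t) ->
     \sum_(c : choice_at m (h t)) weight mu alpha p c * V t.+1 (extend t h (grow c))
     <= V t h) ->
  forall n t h, (t0 <= t)%N -> regular m (h t) ->
    (P (cylinder t h `&` [set w | (1 <= V (t + n)%N (path_of w))%R]) <=
     P (cylinder t h) * (V t h)%:E)%E.
Proof.
move=> V_dep V0 V_step; elim=> [|n IH] t h t0t h_reg.
  rewrite addn0; have [V1|V1] := leP 1 (V t h).
    apply: (@le_trans _ _ (P (cylinder t h))).
      apply: le_measure; rewrite ?inE; last exact: subIsetl.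
        apply: measurableI; first exact: measurable_cylinder.
        apply: (@measurable_path t (fun h => 1 <= V t h)) => h1 h2 h12.
        by rewrite (V_dep t t0t _ _ h12).
      exact: measurable_cylinder.
    by rewrite -[leLHS]mule1 lee_wpmul2l ?lee_fin.
  rewrite (_ : _ `&` _ = set0) ?measure0 ?mule_ge0 ?lee_fin ?V0 //.
  apply/seteqP; split=> // w [Gw] /=; rewrite (V_dep t t0t _ h) ?leNgt ?V1 //.
have mE : measurable [set w | (1 <= V (t + n.+1)%N (path_of w))%R].
  apply: (@measurable_path (t + n.+1)%N (fun h => 1 <= V (t + n.+1)%N h)).
  by move=> h1 h2 h12; rewrite (V_dep _ (leq_trans t0t (leq_addr _ _)) _ _ h12).
apply: (le_trans (le_prob_cylinder h_reg mE)).
have grow_reg (c : choice_at m (h t)) : regular m (extend t h (grow c) t.+1).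
  by rewrite /extend ltnn; exact: regular_add.
apply: (@le_trans _ _ (\sum_(c : choice_at m (h t)) (P (cylinder t h) *
    (weight mu alpha p c * V t.+1 (extend t h (grow c)))%:E))%E).
  apply: lee_sum => c _; rewrite EFinM muleA -prob_cylinder_extend addnS -addSn.
  by apply: IH => //; exact: leqW.
have /fineK <- : P (cylinder t h) \is a fin_num.
  by apply: fin_num_measure; exact: measurable_cylinder.
under eq_bigr do rewrite -EFinM.
rewrite sumEFin -mulr_sumr lee_fin ler_wpM2l ?V_step //.
by rewrite fine_ge0.
Qed.

Lemma cylinder0 : cylinder 0 (fun=> g0) = setT.
Proof.
case: G_pa => _ G0 _; apply/seteqP; split=> // w _ k.
by rewrite leqn0 => /eqP ->; rewrite G0.
Qed.

Definition grows (g g' : mgraph N) : Prop := exists c : choice_at m g, g' = grow c.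

(** The legal transitions have total probability 1. The indicator [V] that an illegal one has
    occurred is constant along legal steps and starts at 0, so [supermartingale_bound] makes the
    event null. *)
Lemma ae_grows : \forall w \ae P, forall t, grows (G t w) (G t.+1 w).
Proof.
pose Q t h := forall k, (k < t)%N -> grows (h k) (h k.+1).
pose V t h : R := if `[< Q t h >] then 0 else 1.
have Q_dep t : depends_upto t (Q t).
  move=> h h' hh'; apply/propext; split=> Qh k kt; have := Qh k kt;
  by rewrite !hh' // ltnW.
have V_dep t : depends_upto t (V t).
  by move=> h h' hh'; rewrite /V (Q_dep t h h').
have V_step t h : (0 <= t)%N -> regular m (h t) ->
    \sum_(c : choice_at m (h t)) weight mu alpha p c * V t.+1 (extend t h (grow c))
    <= V t h.
  move=> _ h_reg; rewrite -[leRHS]mul1r.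
  have /esym -> := weight_sum1 p mu_sum1 alpha_ge0 alpha_col_gt0 h_reg.
  rewrite mulr_suml; apply: ler_sum => c _; rewrite le_eqVlt; apply/orP; left.
  apply/eqP; congr (_ * _); rewrite /V; congr (if _ then _ else _).
  apply: asbool_equiv_eq; split=> Qh k kt.
    by have := Qh k (leqW kt); rewrite /extend kt (ltnW kt).
  move: (kt); rewrite ltnS leq_eqVlt => /predU1P[->|kt'].
    by rewrite /extend leqnn ltnn; exists c.
  by rewrite /extend kt' (ltnW kt'); exact: Qh.
have bound n : (P [set w | (1 <= V n (path_of w))%R] <= 0)%E.
  have := supermartingale_bound (fun t _ => V_dep t) _ V_step n (leqnn 0)
    (regular_initial g0_init : regular m ((fun=> g0) 0%N)).
  rewrite cylinder0 setTI add0n /V asboolT // ?mule0; apply.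
  by move=> t h _; case: ifP.
apply: ae_foralln => t.
exists [set w | (1 <= V t.+1 (path_of w))%R]; split.
- apply: (@measurable_path t.+1 (fun h => 1 <= V t.+1 h)) => h h' hh'.
  by rewrite (V_dep _ _ _ hh').
- by apply/eqP; rewrite eq_le bound measure_ge0.
- move=> w /= nG; rewrite /V; case: asboolP => // Qw.
  by case: nG; exact: Qw.
Qed.

Lemma grows_path h : h 0%N = g0 -> (forall t, grows (h t) (h t.+1)) ->
  forall t, [/\ regular m (h t), nv (h t) = (nv g0 + t)%N
    & forall i s, (s <= t)%N -> (comm_deg (h s) i <= comm_deg (h t) i)%N].
Proof.
move=> h0 hS; elim=> [|t [reg_t nv_t le_t]].
  rewrite h0 addn0; split=> //; first exact: regular_initial.
  by move=> i s; rewrite leqn0 => /eqP ->; rewrite h0.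
have [c hc] := hS t; rewrite hc; split.
- exact: regular_add.
- by rewrite nv_add nv_t addnS.
- move=> i s; rewrite leq_eqVlt => /predU1P[->|]; first by rewrite hc.
  rewrite ltnS => /le_t h1; rewrite (leq_trans (h1 i)) //.
  by rewrite (comm_deg_grow reg_t) leq_addr.
Qed.

(** * Noise of the recursion and its fluctuations *)

Definition rate (g : mgraph N) i : R := m%:R * mu i / (comm_deg g i)%:R.

Definition noise h i t : R :=
  red_prop R (h t.+1) i - red_prop R (h t) i -
  rate (h t) i * ((rule_poly m p).[red_prob alpha (h t) i] - red_prop R (h t) i).

(* X is the noise accumulated since the last restart and J the number of
   restarts; a bound on J for every e makes the partial sums of the noise
   Cauchy. *)
Fixpoint restarts i (e : R) t0 h n : R * nat :=
  if n is n'.+1 then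
    let: (X, J) := restarts i e t0 h n' in
    let X' := X + noise h i (t0 + n') in
    if e < `|X'| then (0, J.+1) else (X', J)
  else (0, 0%N).

Section Restarts.
Variables (i : 'I_N) (e : R) (t0 : nat).
Hypothesis e_gt0 : 0 < e.

Lemma restarts_dep n : depends_upto (t0 + n) (fun h => restarts i e t0 h n).
Proof.
elim: n => [//|n IH] h h' hh' /=.
rewrite (IH h h') => [|k kn]; last by rewrite hh' // addnS leqW.
by rewrite /noise !hh' // addnS.
Qed.

Lemma restarts_norm h n : `|(restarts i e t0 h n).1| <= e.
Proof.
case: n => [|n] /=; first by rewrite normr0 ltW.
by case: restarts => X J; case: ltP => //=; rewrite normr0 ltW.
Qed.

Lemma restarts_le h n n' : (n <= n')%N ->
  ((restarts i e t0 h n).2 <= (restarts i e t0 h n').2)%N.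
Proof.
elim: n' => [|n' IH]; first by rewrite leqn0 => /eqP ->.
rewrite leq_eqVlt => /predU1P[-> //|]; rewrite ltnS => /IH {IH} /=.
by case: (restarts i e t0 h n') => X J /= h1; case: ifP => //= _; exact: leqW.
Qed.

Lemma restarts_sum h n n' : (n <= n')%N ->
  (restarts i e t0 h n).2 = (restarts i e t0 h n').2 ->
  (restarts i e t0 h n').1 - (restarts i e t0 h n).1 =
  \sum_(t0 + n <= k < t0 + n') noise h i k.
Proof.
elim: n' => [|n' IH].
  by rewrite leqn0 => /eqP -> _; rewrite subrr big_geq.
rewrite leq_eqVlt => /predU1P[-> _|]; first by rewrite subrr big_geq.
rewrite ltnS => nn' /=.
have := restarts_le h nn'; have := IH nn'.
case: (restarts i e t0 h n') => X J /= IHX le_J.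
case: ltP => /= _ eJ; first by rewrite eJ ltnn in le_J.
by rewrite addnS big_nat_recr ?leq_add2l //= -IHX // addrAC.
Qed.

End Restarts.

Lemma measurable_restarts i e t0 n j :
  measurable [set w | (j <= (restarts i e t0 (path_of w) n).2)%N].
Proof.
apply: (@measurable_path (t0 + n) (fun h => (j <= (restarts i e t0 h n).2)%N)).
by move=> h1 h2 h12; rewrite (restarts_dep _ _ h12).
Qed.

(** Puts the noise in the shape of [reset_step]: by [excess_mean], the drift is the mean excess over
    the old degree, while the true increment is the excess over the new one. *)
Lemma noise_grow h i t (c : choice_at m (h t)) : regular m (h t) ->
  noise (extend t h (grow c)) i t =
  excess R i c / ((comm_deg (h t) i)%:R + (comm_gain i c)%:R) -
  (\sum_(b : choice_at m (h t)) weight mu alpha p b * excess R i b)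
    / (comm_deg (h t) i)%:R.
Proof.
move=> h_reg; have D0 := comm_deg_gt0 R h_reg i.
have D1 : 0 < (comm_deg (h t) i)%:R + (comm_gain i c)%:R :> R.
  by rewrite ltr_wpDr.
rewrite /noise /extend leqnn ltnn excess_mean // !red_prop_wdeg.
rewrite comm_deg_grow // red_deg_grow // (natrD R (comm_deg _ _)).
rewrite (natrD R (red_deg _ _)) /excess red_prop_wdeg /rate.
move: D0 D1; move: (comm_deg _ _)%:R (comm_gain i c)%:R => D dl D0 D1.
move: (red_deg _ _)%:R (red_gain i c)%:R _.[_] => r dr q.
by field; rewrite !gt_eqF.
Qed.

(** The constant of [reset_step] with K = 2m, a bound on the degree gain of a community in one
    step. *)
Definition noise_const : R := 2 * (2 * m)%:R * ((2 * m)%:R + 3).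

Lemma noise_const_ge0 : 0 <= noise_const.
Proof. by rewrite /noise_const !mulr_ge0 // addr_ge0. Qed.

(** With C the noise constant, X^2 / e^2 + J + C / (e^2 D) is a supermartingale: the last term pays
    for the noise, and a restart adds 1 to J only when X^2 / e^2, then reset to 0, exceeds 1. It
    starts at C / (e^2 D), and after division by j it is at least 1 once J >= j. The assumption e <=
    1 provides the bound on X required by [reset_step]. *)
Lemma restarts_bound i e t0 h n j :
  0 < e -> e <= 1 -> (0 < j)%N -> regular m (h t0) ->
  (P (cylinder t0 h `&` [set w | (j <= (restarts i e t0 (path_of w) n).2)%N]) <=
   P (cylinder t0 h) *
   (noise_const / (e ^+ 2 * (comm_deg (h t0) i)%:R * j%:R))%:E)%E.
Proof.
move=> e0 e1 j0 h_reg.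
have C0 := noise_const_ge0.
pose V t h : R := ((restarts i e t0 h (t - t0)).1 ^+ 2 / e ^+ 2 +
  (restarts i e t0 h (t - t0)).2%:R +
  noise_const / (e ^+ 2 * (comm_deg (h t) i)%:R)) / j%:R.
have V_dep t : (t0 <= t)%N -> depends_upto t (V t).
  move=> t0t h1 h2 h12; rewrite /V h12 //.
  by rewrite (@restarts_dep i e t0 (t - t0) h1 h2) // subnKC.
have V0 t h1 : regular m (h1 t) -> 0 <= V t h1.
  move=> _; apply: divr_ge0 => //; rewrite !addr_ge0 //.
    exact: divr_ge0 (sqr_ge0 _) (sqr_ge0 _).
  exact: divr_ge0 C0 (mulr_ge0 (sqr_ge0 _) _).
have V_step t h1 : (t0 <= t)%N -> regular m (h1 t) ->
    \sum_(c : choice_at m (h1 t)) weight mu alpha p c * V t.+1 (extend t h1 (grow c))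
    <= V t h1.
  move=> t0t h1_reg; rewrite /V subSn //=.
  under eq_bigr => c _.
    rewrite (@restarts_dep i e t0 (t - t0) (extend t h1 (grow c)) h1); last first.
      by move=> k; rewrite subnKC // /extend => ->.
    rewrite subnKC // noise_grow // /extend ltnn comm_deg_grow // mulrA; over.
  rewrite -mulr_suml ler_wpM2r ?invr_ge0 //.
  have := restarts_norm i t0 e0 h1 (t - t0).
  case: (restarts i e t0 h1 (t - t0)) => X J /= Xe.
  pose D : R := (comm_deg (h1 t) i)%:R.
  have D0 : 0 < D := comm_deg_gt0 R h1_reg i.
  have D1 : 1 <= D by case: h1_reg => _ _ hD; rewrite /D ler1n.
  pose X' (c : choice_at m (h1 t)) := X + (excess R i c / (D + (comm_gain i c)%:R) -
     (\sum_(b : choice_at m (h1 t)) weight mu alpha p b * excess R i b) / D).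
  have w1 : \sum_(c : choice_at m (h1 t)) weight mu alpha p c = 1.
    exact: weight_sum1.
  have w0 (c : choice_at m (h1 t)) : 0 <= weight mu alpha p c by exact: weight_ge0.
  have step : \sum_(c : choice_at m (h1 t)) weight mu alpha p c * X' c ^+ 2 <=
      X ^+ 2 + \sum_(c : choice_at m (h1 t)) weight mu alpha p c *
        (noise_const * (D^-1 - (D + (comm_gain i c)%:R)^-1)).
    apply: reset_step => // [c|c|]; [exact: excess_norm| |exact: le_trans e1].
    by rewrite ler_nat comm_gain_le.
  apply: (@le_trans _ _ (\sum_(c : choice_at m (h1 t)) weight mu alpha p c *
     (X' c ^+ 2 / e ^+ 2 + J%:R +
      noise_const / (e ^+ 2 * (D + (comm_gain i c)%:R))))).
    apply: ler_sum => c _; rewrite ler_wpM2l // natrD lerD2r -/(X' c).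
    case: ltP => /= [eX|_] //.
    rewrite expr0n /= mul0r add0r -natr1 addrC lerD2r ler_pdivlMr ?exprn_gt0 //.
    rewrite mul1r -[leRHS]real_normK ?num_real // ler_pXn2r // ?nnegrE //.
      exact: ltW.
    exact: ltW.
  have -> : \sum_(c : choice_at m (h1 t)) weight mu alpha p c *
     (X' c ^+ 2 / e ^+ 2 + J%:R +
      noise_const / (e ^+ 2 * (D + (comm_gain i c)%:R))) =
    (\sum_(c : choice_at m (h1 t)) weight mu alpha p c * X' c ^+ 2 -
     \sum_(c : choice_at m (h1 t)) weight mu alpha p c *
        (noise_const * (D^-1 - (D + (comm_gain i c)%:R)^-1))) / e ^+ 2 +
    J%:R + noise_const / (e ^+ 2 * D).
    have mean_cst x : x = \sum_(c : choice_at m (h1 t)) weight mu alpha p c * x.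
      by rewrite -mulr_suml w1 mul1r.
    rewrite -sumrB mulr_suml -addrA [X in _ = _ + X]mean_cst.
    rewrite -big_split; apply: eq_bigr => c _ /=.
    have D2 : 0 < D + (comm_gain i c)%:R by rewrite ltr_wpDr.
    move: (_%:R) D2 => dl D2; move: (J%:R) noise_const => {}J C.
    by field; rewrite !gt_eqF.
  by rewrite !lerD2r ler_wpM2r ?invr_ge0 ?sqr_ge0 // lerBlDr.
have := supermartingale_bound V_dep V0 V_step n (leqnn t0) h_reg.
have -> : V t0 h = noise_const / (e ^+ 2 * (comm_deg (h t0) i)%:R * j%:R).
  by rewrite /V subnn /= expr0n /= mul0r !add0r [in RHS]invfM mulrA.
apply: le_trans; apply: le_measure; rewrite ?inE.
- apply: measurableI; first exact: measurable_cylinder.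
  exact: measurable_restarts.
- apply: measurableI; first exact: measurable_cylinder.
  apply: (@measurable_path (t0 + n) (fun h => 1 <= V (t0 + n)%N h)).
  by move=> h1 h2 h12; rewrite (V_dep _ (leq_addr _ _) _ _ h12).
- move=> w [Gw /= jJ]; split=> //=.
  rewrite /V addKn ler_pdivlMr ?ltr0n // mul1r addrAC [leRHS]addrC.
  rewrite (@le_trans _ _ (restarts i e t0 (path_of w) n).2%:R) ?ler_nat //.
  rewrite lerDl addr_ge0 //; first exact: divr_ge0 (sqr_ge0 _) (sqr_ge0 _).
  exact: divr_ge0 C0 (mulr_ge0 (sqr_ge0 _) _).
Qed.

Definition restarts_reach i e t0 j : set T :=
  [set w | exists n, (j <= (restarts i e t0 (path_of w) n).2)%N].

Lemma measurable_restarts_reach i e t0 j : measurable (restarts_reach i e t0 j).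
Proof.
have -> : restarts_reach i e t0 j =
    \bigcup_n [set w | (j <= (restarts i e t0 (path_of w) n).2)%N].
  by apply/seteqP; split=> [w [n]|w [n _]]; exists n.
by apply: bigcupT_measurable => n; exact: measurable_restarts.
Qed.

Lemma restarts_reach_bound i e t0 h j :
  0 < e -> e <= 1 -> (0 < j)%N -> regular m (h t0) ->
  (P (cylinder t0 h `&` restarts_reach i e t0 j) <= P (cylinder t0 h) *
   (noise_const / (e ^+ 2 * (comm_deg (h t0) i)%:R * j%:R))%:E)%E.
Proof.
move=> e0 e1 j0 h_reg.
pose F n := cylinder t0 h `&`
  [set w | (j <= (restarts i e t0 (path_of w) n).2)%N].
have UF : cylinder t0 h `&` restarts_reach i e t0 j = \bigcup_n F n.
  by apply/seteqP; split=> [w [Gw [n]]|w [n _ [Gw jn]]]; [exists n|split=> //; exists n].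
have mF n : measurable (F n).
  apply: measurableI; [exact: measurable_cylinder|exact: measurable_restarts].
have mUF : measurable (\bigcup_n F n) by exact: bigcupT_measurable.
have ndF : {homo F : n n' / (n <= n')%N >-> (n <= n')%O}.
  move=> n n' nn'; apply/subsetPset => w [Gw /= jn]; split=> //=.
  exact: leq_trans jn (restarts_le _ _ _ _ nn').
have cvgF := nondecreasing_cvg_mu (mu := P) mF mUF ndF.
rewrite UF -(cvg_lim _ cvgF) //; apply: lime_le; first by apply: cvgP cvgF.
by apply: nearW => n; exact: restarts_bound.
Qed.

Lemma ae_restarts_bounded i e : 0 < e -> e <= 1 ->
  \forall w \ae P, exists j, forall n, ((restarts i e 0 (path_of w) n).2 < j)%N.
Proof.
move=> e0 e1; exists (\bigcap_j restarts_reach i e 0 j); split.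
- by apply: bigcapT_measurable => j; exact: measurable_restarts_reach.
- set C := noise_const / (e ^+ 2 * (comm_deg g0 i)%:R).
  have g0_reg := regular_initial g0_init.
  have C0 : 0 <= C := divr_ge0 noise_const_ge0 (mulr_ge0 (sqr_ge0 _) (ler0n _ _)).
  apply/eqP; rewrite eq_le measure_ge0 andbT; apply/lee_addgt0Pr => x x0.
  rewrite add0e.
  (* Then C / j <= x; the probability of reaching j restarts is thus at most the arbitrary x. *)
  pose j := (Num.truncn (C / x)).+1.
  apply: (@le_trans _ _ (P (restarts_reach i e 0 j))).
    apply: le_measure; rewrite ?inE; last by move=> w; exact.
      by apply: bigcapT_measurable => j'; exact: measurable_restarts_reach.
    exact: measurable_restarts_reach.
  have := restarts_reach_bound i e0 e1 (ltn0Sn (Num.truncn (C / x)))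
    (g0_reg : regular m ((fun=> g0) 0%N)).
  rewrite cylinder0 setTI probability_setT mul1e => /le_trans; apply.
  rewrite lee_fin invfM mulrA -/C ler_pdivrMr ?ltr0n // -ler_pdivrMl //.
  by rewrite mulrC ltW // truncnS_gt.
- move=> w /= /forallNP nJ j _; apply: contrapT => /forallNP Jlt.
  by apply: (nJ j) => n; rewrite ltnNge; apply/negP; exact: Jlt.
Qed.

(** After the last restart, a partial sum of the noise is a difference of two values of X, each of
    size at most e. *)
Lemma restarts_bounded_noise i e h j : 0 < e ->
  (forall n, ((restarts i e 0 h n).2 < j)%N) ->
  exists t1, forall s t, (t1 <= s)%N -> (s <= t)%N ->
    `|\sum_(s <= k < t) noise h i k| <= 2 * e.
Proof.
move=> e0 Jlt.
pose Q k := `[< exists n, (restarts i e 0 h n).2 = k >].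
have Q0 : exists k, Q k by exists 0%N; apply/asboolP; exists 0%N.
have Qle k : Q k -> (k <= j)%N by move=> /asboolP[n <-]; exact: ltnW.
have [k /asboolP[t1 t1k] kmax] := ex_maxnP Q0 Qle.
have Jk n : (t1 <= n)%N -> (restarts i e 0 h n).2 = k.
  move=> t1n; apply/eqP; rewrite eqn_leq kmax; last by apply/asboolP; exists n.
  by rewrite -t1k restarts_le.
exists t1 => s t t1s st; have t1t := leq_trans t1s st.
have := @restarts_sum i e 0 h _ _ st; rewrite Jk // Jk // !add0n => <- //.
rewrite (le_trans (ler_normB _ _)) // mulr2n mulrDl mul1r lerD //;
  exact: restarts_norm.
Qed.

Lemma ae_noise_cauchy : \forall w \ae P, forall i x, 0 < x ->
  exists t1, forall s t, (t1 <= s)%N -> (s <= t)%N ->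
    `|\sum_(s <= k < t) noise (path_of w) i k| <= x.
Proof.
apply: filter_forall => i.
have e0 n : 0 < n.+1%:R^-1 :> R by rewrite invr_gt0.
have e1 n : n.+1%:R^-1 <= 1 :> R by rewrite invf_le1 ?ler1n.
have := ae_foralln (fun n => ae_restarts_bounded i (e0 n) (e1 n)).
apply: filterS => w Jw x x0.
pose n := Num.truncn (2 / x).
have [j Jj] := Jw n; have [t1 ht1] := restarts_bounded_noise (e0 n) Jj.
exists t1 => s t t1s st; rewrite (le_trans (ht1 s t t1s st)) //.
by rewrite ler_pdivrMr // mulrC -ler_pdivrMr // ltW // truncnS_gt.
Qed.

End Process.

(** * Reaching a neighbourhood of a fixed point *)

Section Steering.
Variables (R : realType) (N m : nat).
Variables (mu : 'I_N -> R) (alpha : 'M[R]_N) (p : nat -> R) (z : R).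
Hypothesis mu_gt0 : forall i, 0 < mu i.
Hypothesis alpha_ge0 : forall x y, 0 <= alpha x y.
Hypothesis alpha_col_gt0 : forall y, 0 < \sum_x alpha x y.
Hypothesis p_prob : forall k, (k <= m)%N -> 0 <= p k <= 1.
Hypothesis z01 : 0 <= z <= 1.
Hypothesis z_fix : (rule_poly m p).[z] = z.
Implicit Types (g : mgraph N) (i y : 'I_N).

(** The condition of [attainable] on a single graph, in terms of integer degrees. *)
Definition mixed g : Prop := forall i,
  (0 < z -> (0 < red_deg g i)%N) /\ (z < 1 -> (red_deg g i < comm_deg g i)%N).

(** This is D_i (Z_i - z); unlike Z_i - z, it changes additively under growth. *)
Definition imbalance g i : R := (red_deg g i)%:R - z * (comm_deg g i)%:R.

Definition energy g : R := \sum_i imbalance g i ^+ 2.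

(** Each of the N imbalances moves by at most 2m in a step. *)
Definition energy_const : R := N%:R * (2 * m)%:R ^+ 2.

Lemma mixed_grow g (c : choice_at m g) : regular m g -> mixed g -> mixed (grow c).
Proof.
move=> g_reg g_mix i; have [mr mb] := g_mix i.
rewrite red_deg_grow // comm_deg_grow //; split=> [/mr|/mb].
  by move=> h; rewrite ltn_addr.
by move=> h; rewrite -addSn leq_add // red_gain_le.
Qed.

Lemma wdeg_gt0 g (phi : pred ('I_N * bool)) : (0 < wdeg g phi)%N ->
  exists v : 'I_(nv g), phi (tnth (in_tuple g.1) v) /\ (0 < deg v)%N.
Proof.
move=> h; apply: contrapT => /forallNP nv0; move: h; rewrite /wdeg big1 // => v phiv.
by apply/eqP; rewrite -leqn0 leqNgt; apply/negP => dv; apply: (nv0 v).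
Qed.

(** When z is 0 or 1 one colour may be absent; a vertex of the other colour then plays both
    parts. *)
Lemma mixed_vertices g x : mixed g -> exists vr vb : 'I_(nv g),
  [/\ comm vr = x /\ comm vb = x, (0 < deg vr)%N /\ (0 < deg vb)%N,
      0 < z -> red vr & z < 1 -> ~~ red vb].
Proof.
move=> g_mix; have [mr mb] := g_mix x.
have r : 0 < z -> exists v : 'I_(nv g), [/\ red v, comm v = x & (0 < deg v)%N].
  move=> /mr /wdeg_gt0 [v [/andP[rv /eqP cv] dv]]; exists v; split=> //.
have b : z < 1 -> exists v : 'I_(nv g), [/\ ~~ red v, comm v = x & (0 < deg v)%N].
  move=> /mb h.
  have /wdeg_gt0 [v [/andP[rv /eqP cv] dv]] :
      (0 < wdeg g (fun l => ~~ l.2 && (l.1 == x)))%N.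
    rewrite -(ltn_add2l (red_deg g x)) addn0 (leq_trans h) //.
    rewrite /comm_deg /red_deg /wdeg [leqLHS](bigID (fun v => red v)) /=.
    by rewrite leq_add // leq_eqVlt; apply/orP; left; apply/eqP;
      apply: eq_bigl => v; rewrite andbC.
  by exists v.
have [z0|z0] := ltP 0 z; have [z1|z1] := ltP z 1.
- have [vr [? ? ?]] := r z0; have [vb [? ? ?]] := b z1.
  by exists vr, vb.
- have [vr [? ? ?]] := r z0; by exists vr, vr.
- have [vb [? ? ?]] := b z1; by exists vb, vb.
- by have := le_trans z1 z0; rewrite ler10.
Qed.

(* Choosing k red neighbours and the type b with the weights
   'C(m, k) z^k (1 - z)^(m - k) p_k, resp. 1 - p_k, leaves every imbalance
   unchanged on average because z is a fixed point; hence some admissible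
   choice does not increase the first-order part of the energy. *)
Lemma steering_step g y : regular m g -> mixed g ->
  exists c : choice_at m g, [/\ 0 < weight mu alpha p c, c.1.1 = y
    & energy (grow c) <= energy g + energy_const].
Proof.
move=> g_reg g_mix; have /andP[z0 z1] := z01.
(* All m neighbours will be taken in this one community, so only the imbalances of x and y
   change. *)
have [x ax] : exists x, 0 < alpha x y.
  apply: contrapT => /forallNP nx; have := alpha_col_gt0 y.
  rewrite ltNge big1 ?lexx // => x _; apply/eqP.
  by rewrite eq_le alpha_ge0 andbT leNgt; apply/negP/nx.
have [vr [vb [[cr cb] [dr db] redr redb]]] := mixed_vertices x g_mix.
(* Half of the first-order change of the energy when k neighbours are red and the newcomer has type
   b; [f] is its mean over b. *)
pose phi (k : nat) (b : bool) : R :=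
  imbalance g y * (m%:R * (b%:R - z)) + imbalance g x * (k%:R - m%:R * z).
pose f k : R := imbalance g y * m%:R * p k + (imbalance g x * k%:R
    - m%:R * z * (imbalance g y + imbalance g x)).
have fE k : f k = p k * phi k true + (1 - p k) * phi k false.
  by rewrite /f /phi /=; ring.
(* The binomial mean of [f] at z is [imbalance g y] times m (r(z) - z), hence 0. *)
have [k [km k0 k1 fk]] : exists k, [/\ (k <= m)%N, (0 < k)%N -> 0 < z,
    (k < m)%N -> z < 1 & f k <= 0].
  apply: bin_mean_le0 => //; rewrite !bin_mean_lin bin_mean_cst bin_mean_id.
  by rewrite -rule_polyE z_fix; lra.
have [b pb phib] : exists2 b : bool, 0 < (if b then p k else 1 - p k) & phi k b <= 0.
  have /andP[p0 p1] := p_prob km; move: fk; rewrite fE.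
  have [phit|phit] := leP (phi k true) 0; have [phif|phif] := leP (phi k false) 0.
  - have [pk0|pk0] := ltP 0 (p k); first by exists true.
    by exists false => //=; lra.
  - have [pk0|pk0] := ltP 0 (p k); first by exists true.
    have -> : p k = 0 by apply/eqP; rewrite eq_le pk0.
    by rewrite mul0r add0r subr0 mul1r leNgt phif.
  - have [pk1|pk1] := ltP (p k) 1; first by exists false => //=; rewrite subr_gt0.
    have -> : p k = 1 by apply/eqP; rewrite eq_le p1.
    by rewrite subrr mul0r addr0 mul1r leNgt phit.
  - have [pk0|pk0] := ltP 0 (p k).
      have : 0 < p k * phi k true by rewrite mulr_gt0.
      have : 0 <= (1 - p k) * phi k false by rewrite mulr_ge0 ?subr_ge0 // ltW.
      lra.
    have -> : p k = 0 by apply/eqP; rewrite eq_le pk0.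
    by rewrite mul0r add0r subr0 mul1r leNgt phif.
have s_size : size (nseq k vr ++ nseq (m - k) vb) == m.
  by rewrite size_cat !size_nseq subnKC.
pose s := Tuple s_size.
have s_mem v : v \in (s : seq _) -> v = vr \/ v = vb.
  by rewrite mem_cat !mem_nseq => /orP[]/andP[_ /eqP ->]; [left|right].
have s_red : nb_red s = k.
  rewrite /nb_red count_cat !count_nseq.
  have -> : (red vr * k = k)%N.
    by case: (posnP k) => [->|/k0/redr ->]; rewrite ?muln0 ?mul1n.
  have -> : (red vb * (m - k) = 0)%N; last by rewrite addn0.
  have [km'|mk] := ltnP k m; first by rewrite (negbTE (redb (k1 km'))).
  by rewrite (eqP mk) muln0.
exists (y, s, b); split=> //=.
  rewrite /weight /step_prob /= s_red mulr_gt0 // mulr_gt0 // big_seq.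
  apply: prodr_gt0 => v /s_mem sv.
  apply: divr_gt0; last exact: (attach_total_gt0 alpha_ge0 alpha_col_gt0 g_reg y).
  by case: sv => ->; rewrite ?cr ?cb mulr_gt0 // ltr0n.
pose c : choice_at m g := (y, s, b).
pose dl i : R := (red_gain i c)%:R - z * (comm_gain i c)%:R.
have imbE i : imbalance (grow c) i = imbalance g i + dl i.
  rewrite /imbalance red_deg_grow // comm_deg_grow // /dl.
  rewrite (natrD R (red_deg _ _)) (natrD R (comm_deg _ _)); ring.
have dl_le i : dl i ^+ 2 <= (2 * m)%:R ^+ 2.
  have h1 : (red_gain i c)%:R <= (comm_gain i c)%:R :> R by rewrite ler_nat red_gain_le.
  have h2 : (comm_gain i c)%:R <= (2 * m)%:R :> R by rewrite ler_nat comm_gain_le.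
  have h3 : z * (comm_gain i c)%:R <= 1 * (comm_gain i c)%:R by rewrite ler_wpM2r.
  have h4 : 0 <= z * (comm_gain i c)%:R by rewrite mulr_ge0.
  have h5 : 0 <= (red_gain i c)%:R :> R by [].
  rewrite -[leLHS]real_normK ?num_real // ler_pXn2r ?nnegrE // ler_norml /dl.
  by apply/andP; split; lra.
have dlE i : dl i = (y == i)%:R * (m%:R * (b%:R - z)) +
    (x == i)%:R * (k%:R - m%:R * z).
  have sc v : v \in (s : seq _) -> comm v = x by move=> /s_mem[] ->.
  rewrite /dl.
  have -> : red_gain i c = (m * (b && (y == i)) + (x == i) * k)%N.
    rewrite /red_gain; congr addn; rewrite -[in RHS]s_red /nb_red -sum1_count.
    rewrite [X in (_ * X)%N]big_mkcond big_distrr [LHS]big_seq [RHS]big_seq.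
    by apply: eq_bigr => v vs; rewrite sc //; case: red; rewrite /= ?muln1 ?muln0.
  have -> : comm_gain i c = (m * (y == i) + (x == i) * m)%N.
    rewrite /comm_gain; congr addn; rewrite -{4}(eqP s_size) -sum1_size big_distrr /=.
    rewrite [LHS]big_seq [RHS]big_seq.
    by apply: eq_bigr => v vs; rewrite sc // muln1.
  by rewrite !natrD !natrM -mulnb natrM; ring.
have cross : \sum_i imbalance g i * dl i = phi k b.
  under eq_bigr do rewrite dlE mulrDr !mulrA.
  rewrite big_split /= /phi; congr (_ + _).
    rewrite (bigD1 y) //= eqxx mulr1 big1 ?addr0 ?mulrA // => i.
    by rewrite eq_sym => /negbTE ->; rewrite mulr0 !mul0r.
  rewrite (bigD1 x) //= eqxx mulr1 big1 ?addr0 ?mulrA // => i.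
  by rewrite eq_sym => /negbTE ->; rewrite mulr0 !mul0r.
have -> : energy (grow c) = energy g + 2 * phi k b + \sum_i dl i ^+ 2.
  rewrite -cross mulr_sumr -!big_split /=; apply: eq_bigr => i _.
  by rewrite imbE; ring.
rewrite -addrA lerD2l; have : \sum_i dl i ^+ 2 <= energy_const.
  rewrite /energy_const -[N in N%:R]card_ord -sum1_card natr_sum mulr_suml.
  by apply: ler_sum => i _; rewrite mul1r.
by lra.
Qed.

End Steering.

(** * Positive probability of large, nearly balanced graphs *)

Section Reach.
Variables (R : realType) (d : measure_display) (T : measurableType d).
Variables (P : probability T R) (N m : nat) (mu : 'I_N -> R) (alpha : 'M[R]_N).
Variables (p : nat -> R) (g0 : mgraph N) (G : nat -> T -> mgraph N) (z : R).
Hypothesis m_gt0 : (0 < m)%N.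
Hypothesis mu_gt0 : forall i, 0 < mu i.
Hypothesis mu_sum1 : \sum_i mu i = 1.
Hypothesis alpha_ge0 : forall x y, 0 <= alpha x y.
Hypothesis alpha_col_gt0 : forall y, 0 < \sum_x alpha x y.
Hypothesis p_prob : forall k, (k <= m)%N -> 0 <= p k <= 1.
Hypothesis g0_init : initial_graph g0 m.
Hypothesis G_pa : pa_process m mu alpha p P g0 G.
Hypothesis z01 : 0 <= z <= 1.
Hypothesis z_fix : (rule_poly m p).[z] = z.

(** An event of positive probability keeps positive probability on some cylinder at each successive
    time, because a cylinder has finitely many continuations up to a null set. The cylinder at time
    t fixes the graph, so any point of the intersection shows that it is mixed. *)
Lemma attainable_mixed : attainable P G z ->
  exists t h, [/\ (0 < P (cylinder G t h))%E, regular m (h t) & mixed z (h t)].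
Proof.
move=> [t /=]; set E := [set w | _] => PE.
have mE : measurable E.
  apply: (@measurable_path _ _ _ _ _ _ _ _ _ _ _ G_pa t
    (fun h => forall i, (0 < z -> 0 < red_prop R (h t) i)
                     /\ (z < 1 -> red_prop R (h t) i < 1))) => h h' hh'.
  by rewrite hh'.
have [h [PhE h_reg]] : exists h,
    (0 < P (cylinder G t h `&` E))%E /\ regular m (h t).
  suff : forall n, (n <= t)%N -> exists h,
      (0 < P (cylinder G n h `&` E))%E /\ regular m (h n) by apply.
  elim=> [_|n IH nt].
    exists (fun=> g0); rewrite (cylinder0 G_pa) setTI; split=> //.
    exact: regular_initial.
  have [h [PhE h_reg]] := IH (ltnW nt).
  have [c Pc] : exists c : choice_at m (h n),
      (0 < P (cylinder G n.+1 (extend n h (grow c)) `&` E))%E.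
    apply: contrapT => /forallNP nc; move: PhE; rewrite ltNge; apply/negP.
    rewrite negbK (le_trans (le_prob_cylinder mu_sum1 alpha_ge0 alpha_col_gt0
      G_pa h_reg mE)) // big1 // => c _.
    by apply/eqP; rewrite eq_le measure_ge0 andbT leNgt; apply/negP/nc.
  exists (extend n h (grow c)); split=> //.
  by rewrite /extend ltnn; exact: regular_add.
exists t, h; split=> //.
  apply: (lt_le_trans PhE); apply: le_measure; rewrite ?inE; last exact: subIsetl.
    by apply: measurableI => //; exact: measurable_cylinder G_pa _ _.
  exact: measurable_cylinder G_pa _ _.
have [w [Gw Ew]] : cylinder G t h `&` E !=set0.
  by apply/set0P/negP => /eqP E0; move: PhE; rewrite E0 measure0 ltxx.
move=> i; have := Ew i; rewrite Gw // red_prop_wdeg => -[z0 z1].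
have D0 := comm_deg_gt0 R h_reg i.
split=> [/z0|/z1]; last by rewrite ltr_pdivrMr // mul1r ltr_nat.
by rewrite pmulr_lgt0 ?invr_gt0 // ltr0n.
Qed.

(** The communities of the newcomers are prescribed by [ys]; each newcomer brings its own community
    at least m >= 1 edge-ends. *)
Lemma steering_seq (ys : seq 'I_N) t h :
  (0 < P (cylinder G t h))%E -> regular m (h t) -> mixed z (h t) ->
  exists t' h', [/\ (0 < P (cylinder G t' h'))%E, regular m (h' t'),
    mixed z (h' t'),
    energy z (h' t') <= energy z (h t) + energy_const R N m * (size ys)%:R
    & forall i, (comm_deg (h t) i + count_mem i ys <= comm_deg (h' t') i)%N].
Proof.
elim: ys t h => [|y ys IH] t h Ph h_reg h_mix.
  by exists t, h; split=> //= [|i]; rewrite ?mulr0 ?addr0 ?addn0.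
have [c [wc cy le_c]] := steering_step mu_gt0 alpha_ge0 alpha_col_gt0 p_prob
  z01 z_fix y h_reg h_mix.
pose h1 := extend t h (grow c).
have h1E : h1 t.+1 = grow c by rewrite /h1 /extend ltnn.
have [|||t' [h' [P' reg' mix' le' deg']]] := IH t.+1 h1.
- by rewrite (prob_cylinder_extend G_pa) mule_gt0 // lte_fin.
- by rewrite h1E; exact: regular_add.
- by rewrite h1E; exact: mixed_grow.
exists t', h'; split=> // [|i].
  rewrite (le_trans le') // h1E -[size (y :: ys)]/(size ys).+1 -natr1 mulrDr mulr1.
  lra.
rewrite (leq_trans _ (deg' i)) // h1E comm_deg_grow //= addnA leq_add2r leq_add2l.
by rewrite /comm_gain cy; case: eqP => // _; rewrite muln1 ltn_addr.
Qed.

Lemma steering (K : nat) (x : R) : 0 < x -> attainable P G z ->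
  exists t h, [/\ (0 < P (cylinder G t h))%E, regular m (h t)
    & forall i, (K <= comm_deg (h t) i)%N /\ `|red_prop R (h t) i - z| <= x].
Proof.
move=> x0 /attainable_mixed[t [h [Ph h_reg h_mix]]].
set E0 := energy z (h t).
have E00 : 0 <= E0 by apply: sumr_ge0 => i _; exact: sqr_ge0.
set C := energy_const R N m * N%:R.
have C0 : 0 <= C by rewrite !mulr_ge0.
(* After n rounds through all communities the energy is at most E0 + C n <= (E0 + C) n <= x^2 n^2,
   while every D_i is at least n; hence |Z_i - z| <= x. *)
pose n := maxn K (Num.truncn ((E0 + C) / x ^+ 2)).+1.
have Kn : (K <= n)%N by rewrite leq_max leqnn.
have n1 : (1 <= n)%N by rewrite leq_max ltn0Sn orbT.
have nx : E0 + C <= x ^+ 2 * n%:R.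
  rewrite mulrC -ler_pdivrMr ?exprn_gt0 // (@le_trans _ _
    (Num.truncn ((E0 + C) / x ^+ 2)).+1%:R) //.
    by rewrite ltW // truncnS_gt.
  by rewrite ler_nat leq_maxr.
pose ys := flatten (nseq n (enum 'I_N)).
have size_ys : size ys = (n * N)%N.
  by rewrite size_flatten /shape map_nseq sumn_nseq size_enum_ord mulnC.
have count_ys i : count_mem i ys = n.
  rewrite count_flatten map_nseq sumn_nseq count_uniq_mem ?enum_uniq //.
  by rewrite mem_enum mul1n.
have [t' [h' [P' reg' mix' le' deg']]] := steering_seq ys Ph h_reg h_mix.
exists t', h'; split=> // i.
have nD : (n <= comm_deg (h' t') i)%N.
  by rewrite (leq_trans _ (deg' i)) // count_ys leq_addl.
split; first exact: leq_trans Kn nD.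
have D0 := comm_deg_gt0 R reg' i.
have -> : red_prop R (h' t') i - z = imbalance z (h' t') i / (comm_deg (h' t') i)%:R.
  by rewrite red_prop_wdeg /imbalance mulrBl mulfK ?gt_eqF.
rewrite normrM normfV (ger0_norm (ltW D0)) ler_pdivrMr //.
rewrite -(ler_pXn2r (n := 2)) ?nnegrE ?mulr_ge0 ?(ltW x0) //.
rewrite real_normK ?num_real //.
apply: (@le_trans _ _ (energy z (h' t'))).
  rewrite /energy (bigD1 i) //= lerDl; apply: sumr_ge0 => j _; exact: sqr_ge0.
rewrite (le_trans le') // -/E0 size_ys natrM [n%:R * _]mulrC mulrA -/C.
apply: (@le_trans _ _ ((E0 + C) * n%:R)).
  by rewrite mulrDl lerD2r -[leLHS]mulr1 ler_wpM2l // ler1n.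
apply: (@le_trans _ _ (x ^+ 2 * n%:R * n%:R)); first by rewrite ler_wpM2r.
rewrite exprMn -mulrA ler_wpM2l ?sqr_ge0 // -expr2 ler_pXn2r ?nnegrE //.
by rewrite ler_nat.
Qed.

End Reach.

(** * Convergence of a trajectory *)

(** Doubling blocks: the n0 + n terms starting at index n are each at least c / (2 (n0 + n)), so
    every block adds c / 2. *)
Lemma harmonic_unbounded (R : realType) (a : nat -> R) (c : R) (n0 : nat) :
  0 < c -> (0 < n0)%N -> (forall k, c / (n0 + k)%:R <= a k) ->
  forall t B, exists n, B <= \sum_(t <= k < n) a k.
Proof.
move=> c0 n00 ca t B.
have double j : exists2 n, (t <= n)%N & j%:R * (c / 2) <= \sum_(t <= k < n) a k.
  elim: j => [|j [n tn IH]]; first by exists t => //; rewrite big_geq // mul0r.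
  exists (n + (n0 + n))%N; first by rewrite (leq_trans tn) ?leq_addr.
  rewrite (big_cat_nat tn (leq_addr _ _)) /=.
  rewrite -natr1 mulrDl mul1r lerD //.
  have n0n : 0 < (n0 + n)%:R :> R by rewrite ltr0n ltn_addr.
  apply: (@le_trans _ _ (\sum_(n <= k < n + (n0 + n)) c / (2 * (n0 + n)%:R))).
    rewrite sumr_const_nat addKn -[leRHS]mulr_natr.
    move: ((n0 + n)%:R) n0n => X X0; rewrite le_eqVlt; apply/orP; left; apply/eqP.
    by field; rewrite gt_eqF.
  rewrite !big_nat; apply: ler_sum => k /andP[nk kn]; apply: le_trans (ca k).
  rewrite ler_wpM2l ?(ltW c0) // lef_pV2 ?posrE ?mulr_gt0 ?ltr0n ?addn_gt0 ?n00 //.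
  by rewrite -natrM ler_nat mul2n -addnn -addnA leq_add2l ltnW.
have [n _ hn] := double (Num.truncn (B / (c / 2))).+1.
exists n; rewrite (le_trans _ hn) // -ler_pdivrMr ?divr_gt0 //.
by rewrite ltW // truncnS_gt.
Qed.

(** Countably many tolerances, as needed for the measurability of the convergence event. *)
Lemma cvg_seqP (R : realType) (u : nat -> R) (z : R) :
  u t @[t --> \oo] --> z <->
  forall k, exists n, forall t, (n <= t)%N -> `|u t - z| <= k.+1%:R^-1.
Proof.
split=> [uz k|h].
  have k0 : 0 < k.+1%:R^-1 :> R by rewrite invr_gt0.
  have /cvgrPdist_le /(_ _ k0) [n _ hn] := uz.
  by exists n => t nt; rewrite distrC; exact: hn.
apply/cvgrPdist_le => e e0.
have [n hn] := h (Num.truncn e^-1).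
exists n => // t /= nt; rewrite distrC (le_trans (hn t nt)) //.
by rewrite invf_ple ?posrE // ltW // truncnS_gt.
Qed.

Lemma le_measure_bigsetU d (T : measurableType d) (R : realType)
    (P : probability T R) (I : Type) (s : seq I) (A : I -> set T) :
  (forall i, measurable (A i)) ->
  (P (\big[setU/set0]_(i <- s) A i) <= \sum_(i <- s) P (A i))%E.
Proof.
move=> mA; elim: s => [|i s IH]; first by rewrite !big_nil measure0.
rewrite !big_cons; apply: (le_trans (measureU2 _ _ _)) => //.
  by apply: bigsetU_measurable => j _.
exact: leeD2l.
Qed.

Lemma clamp_le (R : realType) (lo hi x y : R) : x <= y ->
  Num.max lo (Num.min hi x) <= Num.max lo (Num.min hi y).
Proof.
by move=> xy; case: (leP hi x) => ?; case: (leP hi y) => ?; case: (leP lo hi) => ? //;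
  case: (leP lo x) => ? //; case: (leP lo y) => ? //; lra.
Qed.

Lemma clamp_contracting (R : realType) (lo hi x y : R) : x <= y ->
  Num.max lo (Num.min hi y) - Num.max lo (Num.min hi x) <= y - x.
Proof.
move=> xy; case: (leP hi x) => ?; case: (leP hi y) => ?; case: (leP lo hi) => ?;
  case: (leP lo x) => ?; case: (leP lo y) => ?; lra.
Qed.

(** * Monotone extension of the polynomial near a stable fixed point *)

Section Stability.
Variables (R : realType) (r : {poly R}) (z : R).

(** Merges the three cases: with y confined to [0, 1], the condition on the outer side of an
    endpoint is vacuous. *)
Lemma stable_fixpoint_sides : stable_fixpoint r z -> [/\ 0 <= z <= 1, r.[z] = z &
  exists2 eta : R, 0 < eta &
    (forall y, z < y -> y < z + eta -> y <= 1 -> r.[y] < y) /\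
    (forall y, z - eta < y -> y < z -> 0 <= y -> y < r.[y])].
Proof.
move=> [rz [[/andP[z0 z1] [eta eta0 [hl hr]]]|[zE [eta eta0 h]]|[zE [eta eta0 h]]]].
- split=> //; first by rewrite !ltW.
  by exists eta => //; split=> y *; [apply: hr|apply: hl]; apply/andP.
- split=> //; first by rewrite zE lexx ler01.
  rewrite zE; exists eta => //; split=> [y y0|y _ y0 y1].
    by rewrite add0r => yeta _; apply: h; rewrite y0.
  by have := lt_le_trans y0 y1; rewrite ltxx.
- split=> //; first by rewrite zE lexx ler01.
  rewrite zE; exists eta => //; split=> [y y1 _ y1'|y ye y1 _].
    by have := lt_le_trans y1 y1'; rewrite ltxx.
  by apply: h; rewrite ye.
Qed.

(* Clamping the argument of r to a neighbourhood of z makes r globally monotone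
   and turns the boundary cases z = 0 and z = 1 into the interior one. *)
Lemma monotone_extension : stable_fixpoint r z -> increasing_near r z ->
  exists (d0 : R) (F : R -> R), [/\ 0 < d0, {homo F : x y / x <= y},
    forall x, 0 <= x <= 1 -> `|x - z| <= d0 -> F x = r.[x],
    forall x, z < x -> exists2 eta : R, 0 < eta & F (x + eta) <= x - eta
  & forall x, x < z -> exists2 eta : R, 0 < eta & x + eta <= F (x - eta)].
Proof.
move=> /stable_fixpoint_sides[/andP[z0 z1] rz [eta eta0 [rlt rgt]]] [e e0 r_incr].
pose d0 := Num.min e eta / 2.
have m0 : 0 < Num.min e eta by rewrite lt_min e0.
have d00 : 0 < d0 by rewrite divr_gt0.
have d0e : d0 < e by rewrite /d0; have := ge_min e e eta; rewrite lexx /=; lra.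
have d0eta : d0 < eta.
  by rewrite /d0; have := ge_min eta e eta; rewrite lexx orbT /=; lra.
pose lo := Num.max 0 (z - d0); pose hi := Num.min 1 (z + d0).
have lo_z : lo <= z by rewrite /lo ge_max z0 /=; lra.
have z_hi : z <= hi by rewrite /hi le_min z1 /=; lra.
have lo0 : 0 <= lo by rewrite /lo le_max lexx.
have lo1 : z - d0 <= lo by rewrite /lo le_max lexx orbT.
have hi1 : hi <= 1 by rewrite /hi ge_min lexx.
have hi2 : hi <= z + d0 by rewrite /hi ge_min lexx orbT.
pose clamp x := Num.max lo (Num.min hi x).
have lo_hi : lo <= hi := le_trans lo_z z_hi.
have clamp_in x : lo <= clamp x <= hi.
  by rewrite /clamp le_max lexx /= ge_max lo_hi ge_min lexx.
have clamp_homo x y : x <= y -> clamp x <= clamp y.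
  exact: clamp_le.
have clamp_lip x y : x <= y -> clamp y - clamp x <= y - x.
  exact: clamp_contracting.
have clamp_id x : lo <= x <= hi -> clamp x = x.
  by move=> /andP[? ?]; rewrite /clamp min_r // max_r.
have near_z c : lo <= c <= hi -> [/\ 0 <= c <= 1, `|c - z| < e,
    z - eta < c & c < z + eta].
  move=> /andP[? ?]; split; [|rewrite ltr_norml| |]; try (apply/andP; split); lra.
pose F x := r.[clamp x].
have F_above x : z < x -> F x < x.
  move=> zx; have [/andP[_ c1] _ _ ceta] := near_z _ (clamp_in x).
  have cx : clamp x <= x.
    by rewrite /clamp ge_max (le_trans lo_z (ltW zx)) ge_min lexx orbT.
  (* Otherwise the clamp sends x to z itself, as happens for z = 1, and F x = z < x without any use
     of stability. *)
  have [zc|cz] := ltP z (clamp x); first exact: lt_le_trans (rlt _ zc ceta c1) cx.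
  suff -> : F x = z by [].
  rewrite /F (_ : clamp x = z) //; apply/le_anti; rewrite cz /=.
  by rewrite -(clamp_id z) ?lo_z // clamp_homo // ltW.
have F_below x : x < z -> x < F x.
  move=> xz; have [/andP[c0 _] _ ceta _] := near_z _ (clamp_in x).
  have xc : x <= clamp x.
    by rewrite /clamp le_max le_min lexx (le_trans (ltW xz) z_hi) orbT.
  have [cz|zc] := ltP (clamp x) z; first exact: le_lt_trans xc (rgt _ ceta cz c0).
  suff -> : F x = z by [].
  rewrite /F (_ : clamp x = z) //; apply/le_anti; rewrite zc andbT.
  by rewrite -[leRHS](clamp_id z) ?lo_z // clamp_homo // ltW.
have F_cont x x0 : 0 < x0 -> exists2 rho : R, 0 < rho &
    forall y, `|clamp x - clamp y| < rho -> `|F x - F y| < x0.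
  move=> x00; have /cvgrPdist_lt /(_ _ x00) := @continuous_horner _ r (clamp x).
  move=> /nbhs_ballP[rho /= rho0 hrho]; exists rho => // y xy.
  exact: hrho.
exists d0, F; split=> //.
- move=> x y xy; have [c01 ce _ _] := near_z _ (clamp_in x).
  have [c01' ce' _ _] := near_z _ (clamp_in y).
  by apply: r_incr => //; exact: clamp_homo.
- move=> x /andP[x0 x1]; rewrite ler_norml => /andP[xl xh]; rewrite /F clamp_id //.
  by rewrite /lo /hi ge_max le_min x0 x1 /=; apply/andP; split; lra.
- move=> x /F_above Fx.
  (* Half of the gap x - F x absorbs the variation of F between x and x + t; the other half leaves
     room for t. *)
  have g0 : 0 < (x - F x) / 2 by rewrite divr_gt0 // subr_gt0.
  have [rho rho0 hrho] := F_cont x _ g0.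
  pose t := Num.min rho ((x - F x) / 2) / 2.
  have t0 : 0 < t by rewrite divr_gt0 // lt_min rho0.
  have t1 : t < rho.
    by rewrite /t; have := ge_min rho rho ((x - F x) / 2); rewrite lexx /=; lra.
  have t2 : t <= (x - F x) / 2.
    rewrite /t; have := ge_min ((x - F x) / 2) rho ((x - F x) / 2).
    by rewrite lexx orbT; lra.
  exists t => //; have xt : x <= x + t by rewrite lerDl ltW.
  have : `|F x - F (x + t)| < (x - F x) / 2.
    apply: hrho; rewrite distrC ger0_norm ?subr_ge0 ?clamp_homo //.
    by have := clamp_lip _ _ xt; lra.
  by rewrite ltr_norml => /andP[]; lra.
- move=> x /F_below Fx.
  have g0 : 0 < (F x - x) / 2 by rewrite divr_gt0 // subr_gt0.
  have [rho rho0 hrho] := F_cont x _ g0.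
  pose t := Num.min rho ((F x - x) / 2) / 2.
  have t0 : 0 < t by rewrite divr_gt0 // lt_min rho0.
  have t1 : t < rho.
    by rewrite /t; have := ge_min rho rho ((F x - x) / 2); rewrite lexx /=; lra.
  have t2 : t <= (F x - x) / 2.
    rewrite /t; have := ge_min ((F x - x) / 2) rho ((F x - x) / 2).
    by rewrite lexx orbT; lra.
  exists t => //; have xt : x - t <= x by rewrite gerBl ltW.
  have : `|F x - F (x - t)| < (F x - x) / 2.
    apply: hrho; rewrite ger0_norm ?subr_ge0 ?clamp_homo //.
    by have := clamp_lip _ _ xt; lra.
  by rewrite ltr_norml => /andP[]; lra.
Qed.

End Stability.

(** * Limits along one trajectory with summable noise *)

Section Path.
Variables (R : realType) (N m : nat) (mu : 'I_N -> R) (alpha : 'M[R]_N).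
Variables (p : nat -> R) (g0 : mgraph N) (h : nat -> mgraph N).
Hypothesis m_gt0 : (0 < m)%N.
Hypothesis mu_gt0 : forall i, 0 < mu i.
Hypothesis mu_sum1 : \sum_i mu i = 1.
Hypothesis alpha_ge0 : forall x y, 0 <= alpha x y.
Hypothesis alpha_col_gt0 : forall y, 0 < \sum_x alpha x y.
Hypothesis g0_init : initial_graph g0 m.
Hypothesis h0 : h 0%N = g0.
Hypothesis h_grows : forall t, grows m (h t) (h t.+1).
Hypothesis h_noise : forall i x, 0 < x ->
  exists t1, forall s t, (t1 <= s)%N -> (s <= t)%N ->
    `|\sum_(s <= k < t) noise m mu alpha p h i k| <= x.

Let r := rule_poly m p.
Let Y i t := red_prop R (h t) i.
Let q i t := red_prob alpha (h t) i.
Let a i t := rate m mu (h t) i.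

Let h_reg t : regular m (h t).
Proof. by have [] := grows_path g0_init h0 h_grows t. Qed.

Let Y01 i t : 0 <= Y i t <= 1.
Proof. exact: red_prop_01 (h_reg t) i. Qed.

Let q_le i t x : (forall j, Y j t <= x) -> q i t <= x.
Proof. exact: red_prob_le. Qed.

Let q_ge i t x : (forall j, x <= Y j t) -> x <= q i t.
Proof. exact: red_prob_ge. Qed.

Let Y_step i t : Y i t.+1 =
  Y i t + a i t * (r.[q i t] - Y i t) + noise m mu alpha p h i t.
Proof. by rewrite /noise -/(Y i t) -/(Y i t.+1) -/(q i t) -/(a i t) -/r; ring. Qed.

Lemma rate_ge0 i t : 0 <= a i t.
Proof. by rewrite /a /rate divr_ge0 // mulr_ge0 // ltW. Qed.

(** A community's degree is at most the total 2m (n0 + k) at time k, so the rate is at least (mu i /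
    2) / (n0 + k). *)
Lemma rate_unbounded i s B : exists n, B <= \sum_(s <= k < n) a i k.
Proof.
have n00 : (0 < nv g0)%N.
  have [_ _ g0_deg] := regular_initial g0_init.
  have := leq_trans (g0_deg i) (comm_deg_le i (regular_initial g0_init)).
  by rewrite !muln_gt0 => /andP[].
apply: (@harmonic_unbounded _ _ (mu i / 2) (nv g0)) => //.
  by rewrite divr_gt0.
move=> k; have [_ nvk _] := grows_path g0_init h0 h_grows k.
have D0 := comm_deg_gt0 R (h_reg k) i.
have := comm_deg_le i (h_reg k); rewrite nvk -(ler_nat R) !natrM => le_D.
have m0 : 0 < m%:R :> R by rewrite ltr0n.
have n0 : 0 < (nv g0 + k)%:R :> R by rewrite ltr0n ltn_addr.
rewrite /a /rate ler_pdivlMr // mulrAC ler_pdivrMr //.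
apply: (@le_trans _ _ (mu i / 2 * (2 * m%:R * (nv g0 + k)%:R))).
  by rewrite ler_wpM2l // divr_ge0 // ltW.
rewrite le_eqVlt; apply/orP; left; apply/eqP.
by move: (nv g0 + k)%:R => X; field.
Qed.

Lemma path_limit_fix (i0 : 'I_N) z :
  (forall i, Y i t @[t --> \oo] --> z) -> r.[z] = z.
Proof.
move=> Yz; apply/eqP; rewrite -subr_eq0; apply: contrapT => /negP s_neq0.
set s := r.[z] - z in s_neq0.
have s0 : 0 < `|s| by rewrite normr_gt0.
have s4 : 0 < `|s| / 4 by rewrite divr_gt0.
have /cvgrPdist_lt /(_ _ s4) /nbhs_ballP[rho /= rho0 hrho] :=
  @continuous_horner _ r z.
(* Within x of z, both r(q) - r(z) and Y - z are at most |s| / 4, so the drift differs from s by at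
   most |s| / 2. Multiplying it by s treats both signs at once. *)
pose x := Num.min (rho / 2) (`|s| / 4).
have x0 : 0 < x by rewrite lt_min !divr_gt0.
have x1 : x < rho.
  by rewrite /x; have := ge_min (rho / 2) (rho / 2) (`|s| / 4); rewrite lexx /=; lra.
have x2 : x <= `|s| / 4 by rewrite ge_min lexx orbT.
have [T1 hT1] : exists T1, forall t, (T1 <= t)%N -> forall i, `|Y i t - z| <= x.
  have ex i : exists n, forall t, (n <= t)%N -> `|Y i t - z| <= x.
    have /cvgrPdist_le /(_ _ x0) [n _ hn] := Yz i.
    by exists n => t nt; rewrite distrC; exact: hn.
  have [n hn] := choice ex; exists (\max_i n i) => t nt i; apply: hn.
  by rewrite (leq_trans _ nt) //; exact: leq_bigmax.
have [T2 hT2] := h_noise i0 ltr01.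
pose t1 := maxn T1 T2.
have t1T1 : (T1 <= t1)%N by rewrite leq_maxl.
have t1T2 : (T2 <= t1)%N by rewrite leq_maxr.
have drift t : (t1 <= t)%N -> s ^+ 2 / 2 <= s * (r.[q i0 t] - Y i0 t).
  move=> t1t; have near_z := hT1 _ (leq_trans t1T1 t1t).
  have qz : `|z - q i0 t| <= x.
    have q1 : z - x <= q i0 t.
      by apply: q_ge => j; have := near_z j; rewrite ler_norml => /andP[]; lra.
    have q2 : q i0 t <= z + x.
      by apply: q_le => j; have := near_z j; rewrite ler_norml => /andP[]; lra.
    by rewrite ler_norml; apply/andP; split; lra.
  have rq : `|r.[z] - r.[q i0 t]| < `|s| / 4 by apply: hrho; exact: le_lt_trans x1.
  have err : `|r.[q i0 t] - Y i0 t - s| <= `|s| / 2.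
    have -> : r.[q i0 t] - Y i0 t - s = - (r.[z] - r.[q i0 t]) - (Y i0 t - z).
      by rewrite /s; ring.
    rewrite (le_trans (ler_normB _ _)) // normrN.
    by have := near_z i0; lra.
  have : - (s * (r.[q i0 t] - Y i0 t - s)) <= `|s| * (`|s| / 2).
    by rewrite (le_trans (ler_norm _)) // normrN normrM ler_wpM2l.
  rewrite mulrA -expr2 real_normK ?num_real // => h1.
  have -> : s * (r.[q i0 t] - Y i0 t) = s ^+ 2 + s * (r.[q i0 t] - Y i0 t - s).
    by ring.
  lra.
have grow_sum n : s ^+ 2 / 2 * \sum_(t1 <= k < t1 + n) a i0 k <=
    s * (Y i0 (t1 + n)%N - Y i0 t1
         - \sum_(t1 <= k < t1 + n) noise m mu alpha p h i0 k).
  elim: n => [|n IH]; first by rewrite addn0 !big_geq // subrr subr0 !mulr0.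
  rewrite addnS !big_nat_recr ?leq_addr //= Y_step.
  have := ler_wpM2l (rate_ge0 i0 (t1 + n)) (drift _ (leq_addr n t1)).
  by rewrite mulrDr; move: IH; lra.
(* This forces the right side of [grow_sum] up to 7 |s| / 2, whereas a change of Y and a noise sum,
   each at most 1, allow only 2 |s|. *)
have [n hn] := rate_unbounded i0 t1 (7 / `|s|).
have [t1n|/ltnW nt1] := leqP t1 n; last first.
  by move: hn; rewrite big_geq // leNgt divr_gt0.
have := grow_sum (n - t1)%N; rewrite subnKC // leNgt => /negP; apply.
apply: (@lt_le_trans _ _ (s ^+ 2 / 2 * (7 / `|s|))); last first.
  by rewrite ler_wpM2l // divr_ge0 // sqr_ge0.
rewrite -(real_normK (num_real s)) (le_lt_trans (ler_norm _)) // normrM.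
have -> : `|s| ^+ 2 / 2 * (7 / `|s|) = `|s| * (7 / 2) by field; rewrite gt_eqF.
rewrite ltr_pM2l //.
have := hT2 _ _ t1T2 t1n; rewrite ler_norml => /andP[n1 n2].
have /andP[y1 y2] := Y01 i0 t1; have /andP[y3 y4] := Y01 i0 n.
by rewrite ltr_norml; apply/andP; split; lra.
Qed.

(** [barrier] confines the proportions to within d0 / 2 + e <= d0 of z, where [F] agrees with r; so
    the recursion with [F] holds for ever and [eventually_le] applies. Degrees at least m keep the
    rates at most 1. *)
Lemma path_converges z d0 F t0 e :
  0 < d0 -> {homo F : x y / x <= y} ->
  (forall x, 0 <= x <= 1 -> `|x - z| <= d0 -> F x = r.[x]) ->
  (forall x, z < x -> exists2 eta : R, 0 < eta & F (x + eta) <= x - eta) ->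
  (forall x, x < z -> exists2 eta : R, 0 < eta & x + eta <= F (x - eta)) ->
  e <= d0 / 2 ->
  F (z + d0 / 2 + e) + e <= z + d0 / 2 ->
  z - d0 / 2 <= F (z - d0 / 2 - e) - e ->
  (forall i, (m <= comm_deg (h t0) i)%N) ->
  (forall i, `|Y i t0 - z| <= d0 / 2) ->
  (forall i t, (t0 <= t)%N ->
    `|\sum_(t0 <= k < t) noise m mu alpha p h i k| <= e) ->
  forall i, Y i t @[t --> \oo] --> z.
Proof.
move=> d00 F_homo Fr F_above F_below e_d0 Fu Fl D0 init small.
have mu1 i : mu i <= 1.
  by rewrite -mu_sum1 (bigD1 i) //= lerDl; apply: sumr_ge0 => j _; exact: ltW.
have a01 i t : (t0 <= t)%N -> 0 <= a i t <= 1.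
  move=> t0t; rewrite rate_ge0 /= /a /rate.
  have [_ _ /(_ i t0 t0t) le_D] := grows_path g0_init h0 h_grows t.
  rewrite ler_pdivrMr ?(comm_deg_gt0 R (h_reg t)) // mul1r.
  rewrite (@le_trans _ _ m%:R) // ?ler_nat ?(leq_trans (D0 i)) //.
  by rewrite -[leRHS]mulr1 ler_wpM2l.
have F_step i t : (forall j, z - d0 / 2 - e <= Y j t <= z + d0 / 2 + e) ->
    Y i t.+1 = Y i t + a i t * (F (q i t) - Y i t) + noise m mu alpha p h i t.
  move=> Yin; rewrite Fr -?Y_step //.
    apply/andP; split; [apply: q_ge => j|apply: q_le => j];
      by have /andP[] := Y01 j t.
  have q1 : z - d0 <= q i t by apply: q_ge => j; have /andP[] := Yin j; lra.
  have q2 : q i t <= z + d0 by apply: q_le => j; have /andP[] := Yin j; lra.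
  by rewrite ler_norml; apply/andP; split; lra.
have Yin i t : (t0 <= t)%N -> z - d0 / 2 - e <= Y i t <= z + d0 / 2 + e.
  move: i t; apply: (@barrier _ _ Y a q (noise m mu alpha p h) F t0) => //.
  - move=> i; have := init i; rewrite ler_norml => /andP[? ?].
    by apply/andP; split; lra.
  - by move=> i t _ ?; exact: F_step.
  - by move=> i t x _; exact: q_le.
  - by move=> i t x _; exact: q_ge.
have dyn i t : (t0 <= t)%N ->
    Y i t.+1 = Y i t + a i t * (F (q i t) - Y i t) + noise m mu alpha p h i t.
  by move=> t0t; apply: F_step => j; exact: Yin.
have Y1 i t : `|Y i t| <= 1.
  by have /andP[? ?] := Y01 i t; rewrite ger0_norm.
have upper := eventually_le a01 F_homo Y1 F_above rate_unbounded dyn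
  (fun i t x _ => @q_le i t x) h_noise.
(* The lower bound is the upper bound for the reflected system -Y, driven by x |-> - F (- x). *)
have lower : forall i x, 0 < x -> exists n, forall t, (n <= t)%N -> - Y i t <= - z + x.
  apply: (@eventually_le _ _ (fun i t => - Y i t) a (fun i t => - q i t)
    (fun i t => - noise m mu alpha p h i t) (fun x => - F (- x)) t0) => //.
  - by move=> x y xy; rewrite lerN2 F_homo // lerN2.
  - by move=> i t; rewrite normrN.
  - move=> x zx; have [|eta eta0 Feta] := F_below (- x); first by rewrite ltrNl.
    by exists eta => //; rewrite opprD; lra.
  - exact: rate_unbounded.
  - by move=> i t t0t; rewrite dyn // opprK; ring.
  - move=> i t x _ Yx; rewrite lerNl; apply: q_ge => j; rewrite lerNl; exact: Yx.
  - move=> i x x0; have [t1 ht1] := h_noise i x0; exists t1 => s t t1s st.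
    by rewrite sumrN normrN; exact: ht1.
move=> i; apply/cvgrPdist_le => x x0.
have [n1 hn1] := upper i x x0; have [n2 hn2] := lower i x x0.
exists (maxn n1 n2) => // t /=; rewrite geq_max => /andP[/hn1 h1 /hn2 h2].
by rewrite ler_norml; apply/andP; split; lra.
Qed.

End Path.

(** * Probability of convergence *)

Section Convergence.
Variables (R : realType) (d : measure_display) (T : measurableType d).
Variables (P : probability T R) (N m : nat) (mu : 'I_N -> R) (alpha : 'M[R]_N).
Variables (p : nat -> R) (g0 : mgraph N) (G : nat -> T -> mgraph N) (z : R).
Hypothesis m_gt0 : (0 < m)%N.
Hypothesis mu_gt0 : forall i, 0 < mu i.
Hypothesis mu_sum1 : \sum_i mu i = 1.
Hypothesis alpha_ge0 : forall x y, 0 <= alpha x y.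
Hypothesis alpha_col_gt0 : forall y, 0 < \sum_x alpha x y.
Hypothesis p_prob : forall k, (k <= m)%N -> 0 <= p k <= 1.
Hypothesis g0_init : initial_graph g0 m.
Hypothesis G_pa : pa_process m mu alpha p P g0 G.

Lemma measurable_converge_to : measurable (converge_to G z).
Proof.
have -> : converge_to G z = \bigcap_(ik in [set: 'I_N * nat]) \bigcup_n
    \bigcap_(t in [set t | (n <= t)%N])
      [set w | `|red_prop R (path_of G w t) ik.1 - z| <= ik.2.+1%:R^-1].
  apply/seteqP; split=> [w cw [i k] _|w hw i].
    by have [n hn] := (cvg_seqP _ _).1 (cw i) k; exists n.
  by apply/cvg_seqP => k; have [n _ hn] := hw (i, k) I; exists n.
rewrite -[X in measurable X]setCK setC_bigcap; apply: measurableC.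
apply: countable_bigcupT_measurable => [|[i k]]; first exact: countableP.
apply: measurableC; apply: bigcupT_measurable => n.
apply: bigcap_measurableType => t _.
apply: (measurable_path G_pa (t := t)
  (Q := fun h => `|red_prop R (h t) i - z| <= k.+1%:R^-1)).
by move=> h h' hh'; rewrite hh'.
Qed.

Definition good_path (h : nat -> mgraph N) : Prop :=
  (forall t, grows m (h t) (h t.+1)) /\
  (forall i x, 0 < x -> exists t1, forall s t, (t1 <= s)%N -> (s <= t)%N ->
    `|\sum_(s <= k < t) noise m mu alpha p h i k| <= x).

Lemma ae_good_path : \forall w \ae P, good_path (path_of G w).
Proof.
have gr := ae_grows mu_sum1 alpha_ge0 alpha_col_gt0 g0_init G_pa.
have nc := ae_noise_cauchy mu_gt0 mu_sum1 alpha_ge0 alpha_col_gt0 p_prob g0_init G_pa.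
by move: nc; apply: filterS2 gr => w gw nw; split.
Qed.

Lemma le_prob_ae (A B : set T) : measurable A -> measurable B ->
  (\forall w \ae P, A w -> B w) -> (P A <= P B)%E.
Proof.
move=> mA mB [C [mC C0 AB]].
rewrite -(measureU0 mB mC C0); apply: le_measure; rewrite ?inE //.
  exact: measurableU.
move=> w Aw; have [Bw|nBw] := pselect (B w); first by left.
by right; apply: AB => /= h; exact/nBw/h.
Qed.

(** Without a community, convergence to every z would hold vacuously. *)
Lemma comm_exists : exists i : 'I_N, true.
Proof.
apply: contrapT => noi; have := mu_sum1; rewrite big1 => [/esym/eqP|i].
  by rewrite oner_eq0.
by case: noi; exists i.
Qed.

Lemma converge_to_fix : (0 < P (converge_to G z))%E -> (rule_poly m p).[z] = z.
Proof.
have [i0 _] := comm_exists; move=> Pz; apply: contrapT => nfix.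
move: Pz; rewrite ltNge => /negP; apply; rewrite -(measure0 P).
apply: le_prob_ae => //; first exact: measurable_converge_to.
have [_ G0 _] := G_pa.
apply: filterS ae_good_path => w [gw nw] cw; apply: nfix.
exact: (path_limit_fix m_gt0 mu_gt0 alpha_ge0 alpha_col_gt0 g0_init (G0 w) gw nw i0 cw).
Qed.

Lemma converge_to_gt0 : stable_fixpoint (rule_poly m p) z ->
  increasing_near (rule_poly m p) z -> attainable P G z ->
  (0 < P (converge_to G z))%E.
Proof.
move=> z_stab z_incr z_att.
have [z01 z_fix _] := stable_fixpoint_sides z_stab.
have [d0 [F [d00 F_homo Fr F_above F_below]]] := monotone_extension z_stab z_incr.
have d02 : 0 < d0 / 2 by rewrite divr_gt0.
have [|eu eu0 Feu] := F_above (z + d0 / 2); first by rewrite ltrDl.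
have [|el el0 Fel] := F_below (z - d0 / 2); first by rewrite gtrBl.
pose e := Num.min (Num.min eu el) (Num.min (d0 / 2) 1).
have e0 : 0 < e by rewrite !lt_min eu0 el0 d02 /=.
have e_eu : e <= eu by rewrite !ge_min lexx.
have e_el : e <= el by rewrite !ge_min lexx !orbT.
have e_d0 : e <= d0 / 2 by rewrite !ge_min lexx !orbT.
have e1 : e <= 1 by rewrite !ge_min lexx !orbT.
have Fu : F (z + d0 / 2 + e) + e <= z + d0 / 2.
  have : F (z + d0 / 2 + e) <= F (z + d0 / 2 + eu) by apply: F_homo; lra.
  by lra.
have Fl : z - d0 / 2 <= F (z - d0 / 2 - e) - e.
  have : F (z - d0 / 2 - el) <= F (z - d0 / 2 - e) by apply: F_homo; lra.
  by lra.
(* Given the cylinder, each community restarts with probability at most kappa, so some community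
   does with probability at most N kappa < 1. In [K], the bound m serves the rates and the other
   term makes the restart bound at most kappa. *)
pose kappa : R := (2 * N.+1%:R)^-1.
have kappa0 : 0 < kappa by rewrite invr_gt0 mulr_gt0 // ltr0n.
pose K := maxn m (Num.truncn (noise_const R m / (e ^+ 2 * kappa))).+1.
have [t0 [h [Ph h_reg hK]]] := steering m_gt0 mu_gt0 mu_sum1 alpha_ge0 alpha_col_gt0
  p_prob g0_init G_pa z01 z_fix K d02 z_att.
have D_m i : (m <= comm_deg (h t0) i)%N.
  by have [hKi _] := hK i; apply: leq_trans hKi; rewrite leq_max leqnn.
have bad i : (P (cylinder G t0 h `&` restarts_reach m mu alpha p G i e t0 1) <=
    P (cylinder G t0 h) * kappa%:E)%E.
  apply: (le_trans (restarts_reach_bound mu_gt0 mu_sum1 alpha_ge0 alpha_col_gt0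
    p_prob G_pa i e0 e1 (ltn0Sn 0) h_reg)).
  rewrite lee_wpmul2l // lee_fin mulr1.
  have D0 := comm_deg_gt0 R h_reg i.
  rewrite ler_pdivrMr ?mulr_gt0 ?exprn_gt0 //.
  have -> : kappa * (e ^+ 2 * (comm_deg (h t0) i)%:R) =
    (comm_deg (h t0) i)%:R * (e ^+ 2 * kappa) by rewrite mulrCA mulrA mulrC mulrCA.
  rewrite -ler_pdivrMr ?mulr_gt0 ?exprn_gt0 //.
  have [hKi _] := hK i.
  apply: (@le_trans _ _ (Num.truncn (noise_const R m / (e ^+ 2 * kappa))).+1%:R).
    by rewrite ltW // truncnS_gt.
  by rewrite ler_nat (leq_trans _ hKi) // leq_max leqnn orbT.
pose B i := restarts_reach m mu alpha p G i e t0 1.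
have mB i : measurable (B i) := measurable_restarts_reach G_pa i e t0 1.
have mcyl := measurable_cylinder G_pa t0 h.
pose U := \big[setU/set0]_(i < N) (cylinder G t0 h `&` B i).
have mU : measurable U by apply: bigsetU_measurable => i _; exact: measurableI.
have PS : (0 < P (cylinder G t0 h `\` U))%E.
  rewrite ltNge; apply/negP => PS0.
  have : (P (cylinder G t0 h) <= \sum_(i < N) P (cylinder G t0 h) * kappa%:E)%E.
    apply: (@le_trans _ _ (P ((cylinder G t0 h `\` U) `|` U))).
      apply: le_measure; rewrite ?inE //.
        by apply: measurableU => //; exact: measurableD.
      by move=> w Gw; have [|] := pselect (U w); [right|left].
    apply: (le_trans (measureU2 _ _ _)) => //; first exact: measurableD.
    rewrite -[leRHS]add0e; apply: leeD => //.
    apply: le_trans (le_measure_bigsetU _ _ _) _.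
      by move=> i; exact: measurableI.
    by apply: lee_sum => i _; exact: bad.
  have /fineK Pfin : P (cylinder G t0 h) \is a fin_num by exact: fin_num_measure.
  rewrite -Pfin; under eq_bigr do rewrite -EFinM.
  rewrite sumEFin lee_fin sumr_const card_ord -mulrnAr.
  have pc0 : 0 < fine (P (cylinder G t0 h)) by rewrite -lte_fin Pfin.
  rewrite -[leLHS]mulr1 ler_pM2l // leNgt => /negP; apply.
  rewrite /kappa -mulr_natr invfM mulrAC -mulrA.
  have N0 : 0 < N.+1%:R :> R by rewrite ltr0n.
  have : N%:R / N.+1%:R <= 1 :> R by rewrite ler_pdivrMr // mul1r ler_nat.
  by rewrite mulrC => h1; apply: (le_lt_trans (ler_wpM2l _ h1)) => //; lra.
apply: (lt_le_trans PS); apply: le_prob_ae.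
- exact: measurableD.
- exact: measurable_converge_to.
have [_ G0 _] := G_pa.
apply: filterS ae_good_path => w [gw nw] [Gw nU].
have small i t : (t0 <= t)%N ->
    `|\sum_(t0 <= k < t) noise m mu alpha p (path_of G w) i k| <= e.
  move=> t0t.
  (* Without a restart, X is the whole noise sum since t0, hence at most e in size. *)
  have J0 n : (restarts m mu alpha p i e t0 (path_of G w) n).2 = 0%N.
    apply/eqP; rewrite -leqn0 leqNgt; apply/negP => J; apply: nU.
    rewrite /U -bigcup_seq; exists i; first exact: mem_index_enum.
    by split; [exact: Gw|exists n; exact: J].
  have := @restarts_sum R N m mu alpha p i e t0 (path_of G w) 0 (t - t0) (leq0n _).
  by rewrite !J0 addn0 subnKC //= subr0 => <- //; exact: restarts_norm.
have Gt0 : path_of G w t0 = h t0 by exact: Gw.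
apply: (path_converges m_gt0 mu_gt0 mu_sum1 alpha_ge0 alpha_col_gt0 g0_init
  (G0 w) gw nw d00 F_homo Fr F_above F_below e_d0 Fu Fl (t0 := t0)) => //.
- by move=> i; rewrite Gt0.
- by move=> i; rewrite Gt0; have [] := hK i.
Qed.

End Convergence.

Theorem theorem3p8 (R : realType) (d : measure_display) (T : measurableType d)
    (P : probability T R) (N m : nat) (mu : 'I_N -> R) (alpha : 'M[R]_N)
    (p : nat -> R) (g0 : mgraph N) (G : nat -> T -> mgraph N)
    (m_gt0 : (0 < m)%N)
    (mu_gt0 : forall i, 0 < mu i)
    (mu_sum1 : \sum_i mu i = 1)
    (alpha_ge0 : forall x y, 0 <= alpha x y)
    (alpha_col_gt0 : forall y, 0 < \sum_x alpha x y)
    (p_prob : forall k, (k <= m)%N -> 0 <= p k <= 1)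
    (g0_init : initial_graph g0 m)
    (G_pa : pa_process m mu alpha p P g0 G) :
  (forall z : R,
     stable_fixpoint (rule_poly m p) z ->
     increasing_near (rule_poly m p) z ->
     attainable P G z ->
     (0 < P (converge_to G z))%E)
  /\
  (forall z : R,
     (0 < P (converge_to G z))%E ->
     (rule_poly m p).[z] = z).
Proof.
split=> z.
  exact: (converge_to_gt0 m_gt0 mu_gt0 mu_sum1 alpha_ge0 alpha_col_gt0 p_prob
    g0_init G_pa).
exact: (converge_to_fix m_gt0 mu_gt0 mu_sum1 alpha_ge0 alpha_col_gt0 p_prob
  g0_init G_pa).
Qed.
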